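(* Let $U$ be a complete length $\mathrm{CAT}(1)$ space. Assume there is a point $p\in U$ such that $|p-x|\le\tfrac\pi2$ for every $x\in U$. Then $U$ is $1$-complemented; that is, for some non-principal ultrafilter $\omega$ on $\mathbb{N}$ there exists a short retraction of the ultracompletion $U^\omega$ onto $U$.
   Context: For a non-principal ultrafilter $\omega$ on $\mathbb{N}$ and a bounded metric space $U$ (the space here has diameter at most $\pi$), the ultracompletion $U^\omega$ is the set of all sequences $(x_n)$ in $U$ modulo the relation $(x_n)\sim(y_n)$ iff $\lim_\omega |x_n-y_n|=0$, with metric $|(x_n)-(y_n)|=\lim_\omega|x_n-y_n|$; $U$ is regarded as a subset of $U^\omega$ via constant sequences. A short retraction of $U^\omega$ onto $U$ is a 1-Lipschitz map $U^\omega\to U$ that restricts to the identity on $U$. A metric space is $1$-complemented if for some non-principal ultrafilter $\omega$ there is a short retraction $U^\omega\to U$. *)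

(* Defs.v *)
From Stdlib Require Import Reals.
Open Scope R_scope.

Definition is_metric {X : Type} (d : X -> X -> R) : Prop :=
  (forall x y, 0 <= d x y) /\
  (forall x y, d x y = 0 <-> x = y) /\
  (forall x y, d x y = d y x) /\
  (forall x y z, d x z <= d x y + d y z).

Definition cauchy_seq {X : Type} (d : X -> X -> R) (u : nat -> X) : Prop :=
  forall eps, 0 < eps -> exists N, forall m n, (N <= m)%nat -> (N <= n)%nat ->
    d (u m) (u n) < eps.

Definition converges_to {X : Type} (d : X -> X -> R) (u : nat -> X) (l : X) : Prop :=
  forall eps, 0 < eps -> exists N, forall n, (N <= n)%nat -> d (u n) l < eps.

Definition complete {X : Type} (d : X -> X -> R) : Prop :=
  forall u, cauchy_seq d u -> exists l, converges_to d u l.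

Definition curve_continuous {X : Type} (d : X -> X -> R) (c : R -> X) : Prop :=
  forall s, 0 <= s <= 1 -> forall eps, 0 < eps -> exists delta, 0 < delta /\
    forall s', 0 <= s' <= 1 -> Rabs (s - s') < delta -> d (c s) (c s') < eps.

Definition partition01 (t : nat -> R) (n : nat) : Prop :=
  t O = 0 /\ t (S n) = 1 /\ (forall i, (i <= n)%nat -> t i <= t (S i)).

Definition length_le {X : Type} (d : X -> X -> R) (c : R -> X) (L : R) : Prop :=
  forall t n, partition01 t n ->
    sum_f_R0 (fun i => d (c (t i)) (c (t (S i)))) n <= L.

(* length space: the distance is the infimum of lengths of curves
   (curve lengths are always >= the distance, so it suffices to ask for
   curves of length <= d x y + eps for every eps > 0). *)
Definition length_space {X : Type} (d : X -> X -> R) : Prop :=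
  forall x y eps, 0 < eps -> exists c : R -> X,
    curve_continuous d c /\ c 0 = x /\ c 1 = y /\ length_le d c (d x y + eps).

Definition geodesic {X : Type} (d : X -> X -> R) (x y : X) (g : R -> X) : Prop :=
  g 0 = x /\ g (d x y) = y /\
  forall s t, 0 <= s <= d x y -> 0 <= t <= d x y -> d (g s) (g t) = Rabs (s - t).

Definition R3 := (R * R * R)%type.
Definition dot3 (u v : R3) : R :=
  let '(u1, u2, u3) := u in let '(v1, v2, v3) := v in u1 * v1 + u2 * v2 + u3 * v3.
Definition on_S2 (u : R3) : Prop := dot3 u u = 1.
Definition sdist (u v : R3) : R := acos (dot3 u v).

(** * CAT(1) (Bridson--Haefliger definition) *)
(* p lies on the side g (geodesic from x to y) at parameter t, and pt is the
   corresponding point on the side [ux,uy] of the comparison triangle *)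
Definition side_point {X : Type} (d : X -> X -> R) (x y : X) (g : R -> X)
    (ux uy : R3) (p : X) (pt : R3) : Prop :=
  exists t, 0 <= t <= d x y /\ p = g t /\
    on_S2 pt /\ sdist ux pt = t /\ sdist pt uy = d x y - t.

Definition CAT1 {X : Type} (d : X -> X -> R) : Prop :=
  (forall x y, d x y < PI -> exists g, geodesic d x y g) /\
  (forall x1 x2 x3 g12 g23 g31,
    geodesic d x1 x2 g12 -> geodesic d x2 x3 g23 -> geodesic d x3 x1 g31 ->
    d x1 x2 + d x2 x3 + d x3 x1 < 2 * PI ->
    forall u1 u2 u3 : R3, on_S2 u1 -> on_S2 u2 -> on_S2 u3 ->
      sdist u1 u2 = d x1 x2 -> sdist u2 u3 = d x2 x3 -> sdist u3 u1 = d x3 x1 ->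
      let on_tri := fun p pt =>
        side_point d x1 x2 g12 u1 u2 p pt \/
        side_point d x2 x3 g23 u2 u3 p pt \/
        side_point d x3 x1 g31 u3 u1 p pt in
      forall p q pt qt, on_tri p pt -> on_tri q qt -> d p q <= sdist pt qt).

Definition ultrafilter (w : (nat -> Prop) -> Prop) : Prop :=
  w (fun _ => True) /\
  ~ w (fun _ => False) /\
  (forall A B : nat -> Prop, (forall n, A n -> B n) -> w A -> w B) /\
  (forall A B : nat -> Prop, w A -> w B -> w (fun n => A n /\ B n)) /\
  (forall A : nat -> Prop, w A \/ w (fun n => ~ A n)).

Definition nonprincipal (w : (nat -> Prop) -> Prop) : Prop :=
  forall k : nat, ~ w (fun n => n = k).

Definition ulim (w : (nat -> Prop) -> Prop) (a : nat -> R) (L : R) : Prop :=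
  forall eps, 0 < eps -> w (fun n => Rabs (a n - L) < eps).

(** * Short retraction of the ultracompletion U^w onto U.
   A map U^w -> U is represented by a map f on sequences; the 1-Lipschitz
   condition |f x - f y| <= lim_w |x_n - y_n| forces f to be constant on
   ~-classes, so such f are exactly the short maps U^w -> U.  Restricting to
   the identity on U means f (constant sequence x) = x. *)
Definition short_retraction {X : Type} (d : X -> X -> R)
    (w : (nat -> Prop) -> Prop) (f : (nat -> X) -> X) : Prop :=
  (forall (x y : nat -> X) (L : R), ulim w (fun n => d (x n) (y n)) L ->
     d (f x) (f y) <= L) /\
  (forall x : X, f (fun _ => x) = x).

Definition one_complemented {X : Type} (d : X -> X -> R) : Prop :=
  exists w, ultrafilter w /\ nonprincipal w /\
    exists f : (nat -> X) -> X, short_retraction d w f.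

(* Main.v *)
Require Import Defs.
From Stdlib Require Import Reals Lra Lia ClassicalEpsilon.
From Coquelicot Require Import Coquelicot.
From mathcomp Require ssrnat filter.
Open Scope R_scope.

(* In a complete CAT(0) space nearest-point projections onto closed convex sets are short.
   The Euclidean cone over a space of diameter at most PI is CAT(0) as soon as any two of
   its vectors v and w have a sum u, in the weak sense that u is no longer than v + w
   should be and <z, v> + <z, w> <= <z, u> for every z.  A CAT(1) space has such sums, and
   they pass to ultralimits; so the cone over the ultracompletion of U is CAT(0), and the
   cone C over U is a complete convex subcone of it.  Consider the decreasing family of
   convex cones
     K_t = { v | t |v - C| <= (1 - t) <v, p> },   0 <= t <= 1,
   where K_0 is the whole space, because |p - x| <= PI/2, and K_1 = C.  A vector v of K_s
   lies within 6 (t - s) |v| of K_t, and projecting onto a cone changes the norm only by a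
   quadratic amount.  Hence projecting successively onto K_t along finer and finer
   subdivisions of [0, 1] converges to a short map which preserves norms and fixes C; on
   unit vectors it is the required retraction. *)

Lemma pow2_le_reg (a b : R) : 0 <= b -> a ^ 2 <= b ^ 2 -> a <= b.
Proof. nra. Qed.

Lemma pow2_lt_reg (a b : R) : 0 <= b -> a ^ 2 < b ^ 2 -> a < b.
Proof. nra. Qed.

Lemma INR_pow2 (m : nat) : INR (2 ^ m) = 2 ^ m.
Proof. apply pow_INR. Qed.

Lemma div_pow2_lt (c e : R) : 0 < e ->
  exists N, forall n, (N <= n)%nat -> c / 2 ^ n < e.
Proof.
  intros He. destruct (cv_pow_half c e He) as [N HN].
  exists N. intros n Hn. specialize (HN n Hn).
  unfold Rdist in HN. apply Rabs_def2 in HN. lra.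
Qed.

Lemma div_pow2_pos (c : R) (n : nat) : 0 < c -> 0 < c / 2 ^ n.
Proof. intros Hc. apply Rdiv_lt_0_compat; [exact Hc|apply pow_lt; lra]. Qed.

Lemma is_lim_seq_div_pow2 (c : R) : is_lim_seq (fun n => c / 2 ^ n) 0.
Proof. apply is_lim_seq_Reals, cv_pow_half. Qed.

Lemma pow2_add_le_weighted (a b t : R) : 0 < t < 1 ->
  (a + b) ^ 2 <= a ^ 2 / t + b ^ 2 / (1 - t).
Proof.
  intros Ht.
  assert (E : a ^ 2 / t + b ^ 2 / (1 - t) - (a + b) ^ 2
    = (a * (1 - t) - b * t) ^ 2 / (t * (1 - t))) by (field; lra).
  assert (0 <= (a * (1 - t) - b * t) ^ 2 / (t * (1 - t))).
  { apply Rle_mult_inv_pos; [apply pow2_ge_0|nra]. }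
  lra.
Qed.

(* The right-hand side is minimal, equal to [2 a c], at [k = a / c]; the perturbation
   [e] accommodates [a = 0] and [c = 0]. *)
Lemma le_double_mult_of_weighted (a c x : R) : 0 <= a -> 0 <= c ->
  (forall k, 0 < k -> x <= a ^ 2 / k + k * c ^ 2) -> x <= 2 * a * c.
Proof.
  intros Ha Hc H. apply Rle_plus_epsilon. intros eps Heps.
  set (e := eps / (a + c + 1)).
  assert (He : 0 < e) by (apply Rdiv_lt_0_compat; lra).
  assert (Hsmall : e * (a + c) <= eps).
  { assert (e * (a + c + 1) = eps) by (unfold e; field; lra). lra. }
  specialize (H ((a + e) / (c + e)) ltac:(apply Rdiv_lt_0_compat; lra)).
  assert (Hl : a ^ 2 / ((a + e) / (c + e)) <= a * (c + e)).
  { apply Rle_div_l; [apply Rdiv_lt_0_compat; lra|].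
    replace (a * (c + e) * ((a + e) / (c + e))) with (a * (a + e)) by (field; lra). nra. }
  assert (Hr : (a + e) / (c + e) * c ^ 2 <= (a + e) * c).
  { replace ((a + e) / (c + e) * c ^ 2) with ((a + e) * c ^ 2 / (c + e)) by (field; lra).
    apply Rle_div_l; [lra|]. assert (0 <= (a + e) * c) by nra. nra. }
  lra.
Qed.

Lemma infimum_approached {Y : Type} (K : Y -> Prop) (f : Y -> R) (b : R) :
  (exists z, K z) -> (forall z, K z -> b <= f z) ->
  exists m, (forall z, K z -> m <= f z) /\
    forall e, 0 < e -> exists z, K z /\ f z < m + e.
Proof.
  intros [z0 Hz0] Hb.
  destruct (completeness (fun r => exists z, K z /\ r = - f z)) as [s [Hub Hlub]].
  - exists (- b). intros r [z [Hz ->]]. specialize (Hb z Hz). lra.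
  - exists (- f z0), z0. auto.
  - exists (- s). split.
    + intros z Hz. assert (- f z <= s) by (apply Hub; exists z; auto). lra.
    + intros e He. apply NNPP. intros Hfar.
      assert (s <= s - e); [|lra].
      apply Hlub. intros r [z [Hz ->]].
      destruct (Rlt_or_le (f z) (- s + e)) as [H|H]; [|lra].
      exfalso. apply Hfar. exists z. auto.
Qed.

(** * Nonpositively curved pseudometric spaces *)

Record is_pseudometric {Y : Type} (D : Y -> Y -> R) : Prop := {
  pdist_ge0 : forall v w, 0 <= D v w;
  pdist_refl : forall v, D v v = 0;
  pdist_sym : forall v w, D v w = D w v;
  pdist_triangle : forall u v w, D u w <= D u v + D v w }.

Arguments pdist_ge0 {Y D}.
Arguments pdist_refl {Y D}.
Arguments pdist_sym {Y D}.
Arguments pdist_triangle {Y D}.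

Lemma is_metric_pseudometric {Y : Type} (D : Y -> Y -> R) : is_metric D -> is_pseudometric D.
Proof.
  intros [Hge0 [Heq [Hsym Htri]]]. split; auto. intros v. apply Heq. reflexivity.
Qed.

Definition complete_set {Y : Type} (D : Y -> Y -> R) (K : Y -> Prop) : Prop :=
  forall u, (forall n, K (u n)) -> cauchy_seq D u -> exists l, K l /\ converges_to D u l.

(* [comb t v w] stands for the point dividing the geodesic from [v] to [w] in the
   ratio [t : 1 - t]; the inequality is the CAT(0) condition of Bruhat and Tits. *)
Definition npc_combination {Y : Type} (D : Y -> Y -> R) (comb : R -> Y -> Y -> Y) : Prop :=
  forall t v w z, 0 <= t <= 1 ->
    D z (comb t v w) ^ 2
      <= (1 - t) * D z v ^ 2 + t * D z w ^ 2 - t * (1 - t) * D v w ^ 2.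

Definition convex_set {Y : Type} (comb : R -> Y -> Y -> Y) (K : Y -> Prop) : Prop :=
  forall t v w, 0 <= t <= 1 -> K v -> K w -> K (comb t v w).

(* The second clause says that the angle at [P v] between [v] and any point of [K]
   is at least [PI / 2]. *)
Definition is_projection {Y : Type} (D : Y -> Y -> R) (K : Y -> Prop) (P : Y -> Y) : Prop :=
  forall v, K (P v) /\ forall z, K z -> D v (P v) ^ 2 + D (P v) z ^ 2 <= D v z ^ 2.

Definition nearest {Y : Type} (D : Y -> Y -> R) (K : Y -> Prop) (v : Y) : Y :=
  epsilon (inhabits v) (fun l => K l /\ forall z, K z -> D v l <= D v z).

Section Pseudometric.

Context {Y : Type} {D : Y -> Y -> R} (D_pm : is_pseudometric D).

Lemma converges_to_const (v : Y) : converges_to D (fun _ => v) v.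
Proof. intros e He. exists O. intros n _. rewrite (pdist_refl D_pm). exact He. Qed.

Lemma dist_is_lim_seq (u u' : nat -> Y) (l l' : Y) :
  converges_to D u l -> converges_to D u' l' ->
  is_lim_seq (fun n => D (u n) (u' n)) (D l l').
Proof.
  intros Hu Hu'. apply is_lim_seq_Reals. intros e He.
  destruct (Hu (e / 2) ltac:(lra)) as [N HN]. destruct (Hu' (e / 2) ltac:(lra)) as [N' HN'].
  exists (max N N'). intros n Hn.
  specialize (HN n ltac:(lia)). specialize (HN' n ltac:(lia)).
  pose proof (pdist_triangle D_pm (u n) l (u' n)). pose proof (pdist_triangle D_pm l l' (u' n)).
  pose proof (pdist_triangle D_pm l (u n) l'). pose proof (pdist_triangle D_pm (u n) (u' n) l').
  rewrite (pdist_sym D_pm l' (u' n)), (pdist_sym D_pm l (u n)) in *.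
  unfold Rdist. apply Rabs_def1; lra.
Qed.

Lemma dist_lim_le (u u' : nat -> Y) (l l' : Y) (c : R) :
  converges_to D u l -> converges_to D u' l' -> (forall n, D (u n) (u' n) <= c) -> D l l' <= c.
Proof.
  intros Hu Hu' Hle.
  exact (is_lim_seq_le _ (fun _ => c) (D l l') c Hle (dist_is_lim_seq u u' l l' Hu Hu')
    (is_lim_seq_const c)).
Qed.

Lemma complete_sublevel (f : Y -> R) : (forall v w, f v <= f w + D v w) ->
  complete_set D (fun _ => True) -> complete_set D (fun v => f v <= 0).
Proof.
  intros Hlip Hcomp u Hu Hc. destruct (Hcomp u (fun _ => I) Hc) as [l [_ Hl]].
  exists l. split; [|exact Hl].
  apply Rle_plus_epsilon. intros e He. destruct (Hl e He) as [N HN].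
  specialize (HN N (Nat.le_refl _)). specialize (Hu N). cbv beta in Hu.
  pose proof (Hlip l (u N)). rewrite (pdist_sym D_pm l) in *. lra.
Qed.

Lemma npc_combination_swap (comb : R -> Y -> Y -> Y) : npc_combination D comb ->
  npc_combination D (fun t v w => comb (1 - t) w v).
Proof.
  intros Hnpc t v w z Ht. pose proof (Hnpc (1 - t) w v z ltac:(lra)) as H.
  rewrite (pdist_sym D_pm w v) in H. lra.
Qed.

Lemma comb_dist_l (comb : R -> Y -> Y -> Y) (t : R) (v w : Y) :
  npc_combination D comb -> 0 <= t <= 1 -> D v (comb t v w) <= t * D v w.
Proof.
  intros Hnpc Ht. pose proof (pdist_ge0 D_pm v w). apply pow2_le_reg; [nra|].
  pose proof (Hnpc t v w v Ht) as Hvwv. rewrite (pdist_refl D_pm) in Hvwv. nra.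
Qed.

Lemma comb_dist_common_l (comb : R -> Y -> Y -> Y) (t : R) (v w w' : Y) :
  npc_combination D comb -> 0 <= t <= 1 ->
  D (comb t v w) (comb t v w') <= t * D w w'.
Proof.
  intros Hnpc Ht. pose proof (pdist_ge0 D_pm w w'). apply pow2_le_reg; [nra|].
  pose proof (Hnpc t v w' (comb t v w) Ht) as Hcomb.
  pose proof (Hnpc t v w v Ht) as Hv. pose proof (Hnpc t v w w' Ht) as Hw'.
  rewrite (pdist_refl D_pm) in Hv.
  rewrite (pdist_sym D_pm (comb t v w) v), (pdist_sym D_pm (comb t v w) w') in Hcomb.
  rewrite (pdist_sym D_pm w' v), (pdist_sym D_pm w' w) in Hw'.
  apply (Rmult_le_compat_l (1 - t)) in Hv; [|lra].
  apply (Rmult_le_compat_l t) in Hw'; [|lra].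
  nra.
Qed.

Lemma comb_dist (comb : R -> Y -> Y -> Y) (t : R) (v v' w w' : Y) :
  npc_combination D comb -> 0 <= t <= 1 ->
  D (comb t v w) (comb t v' w') <= (1 - t) * D v v' + t * D w w'.
Proof.
  intros Hnpc Ht.
  pose proof (comb_dist_common_l comb t v' w w' Hnpc Ht).
  pose proof (comb_dist_common_l _ (1 - t) w v v' (npc_combination_swap comb Hnpc) ltac:(lra))
    as Hv. cbv beta in Hv. replace (1 - (1 - t)) with t in Hv by ring.
  pose proof (pdist_triangle D_pm (comb t v w) (comb t v' w) (comb t v' w')). lra.
Qed.

Lemma comb_dist_weighted (comb : R -> Y -> Y -> Y) (t : R) (v w x y : Y) :
  npc_combination D comb -> 0 < t < 1 ->
  D x y ^ 2 <= D x (comb t v w) ^ 2 / t + D y (comb t v w) ^ 2 / (1 - t).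
Proof.
  intros Hnpc Ht. apply Rle_trans with (2 := pow2_add_le_weighted _ _ t Ht).
  apply pow_incr. split; [apply (pdist_ge0 D_pm)|].
  rewrite (pdist_sym D_pm y). apply (pdist_triangle D_pm).
Qed.

(* Reshetnyak's inequality: join [b] and [e] through the points of the diagonal [ac]. *)
Lemma quadrilateral (comb : R -> Y -> Y -> Y) (a b c e : Y) : npc_combination D comb ->
  D a c ^ 2 + D b e ^ 2 <= D b c ^ 2 + D e a ^ 2 + 2 * D a b * D c e.
Proof.
  intros Hnpc.
  enough (D a c ^ 2 + D b e ^ 2 - D b c ^ 2 - D e a ^ 2 <= 2 * D a b * D c e) by lra.
  apply le_double_mult_of_weighted; [apply (pdist_ge0 D_pm)..|]. intros k Hk.
  set (t := k / (1 + k)).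
  assert (E1 : 1 - t = / (1 + k)) by (unfold t; field; lra).
  assert (Ht : 0 < t < 1).
  { split; [apply Rdiv_lt_0_compat; lra|].
    pose proof (Rinv_0_lt_compat (1 + k) ltac:(lra)). lra. }
  pose proof (comb_dist_weighted comb t a c b e Hnpc Ht) as Hbe.
  pose proof (Hnpc t a c b ltac:(lra)) as Hb. pose proof (Hnpc t a c e ltac:(lra)) as He.
  rewrite (pdist_sym D_pm b a) in Hb. rewrite (pdist_sym D_pm e c) in He.
  apply (Rmult_le_compat_r (/ t)) in Hb; [|left; apply Rinv_0_lt_compat; lra].
  apply (Rmult_le_compat_r (/ (1 - t))) in He; [|left; apply Rinv_0_lt_compat; lra].
  replace (((1 - t) * D a b ^ 2 + t * D b c ^ 2 - t * (1 - t) * D a c ^ 2) * / t)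
    with (D a b ^ 2 / k + D b c ^ 2 - (1 - t) * D a c ^ 2) in Hb
    by (rewrite E1; unfold t; field; lra).
  replace (((1 - t) * D e a ^ 2 + t * D c e ^ 2 - t * (1 - t) * D a c ^ 2) * / (1 - t))
    with (D e a ^ 2 + k * D c e ^ 2 - t * D a c ^ 2) in He
    by (rewrite E1; unfold t; field; lra).
  unfold Rdiv in *. lra.
Qed.

Section Projection.

Context (comb : R -> Y -> Y -> Y) (K : Y -> Prop).
Hypothesis comb_npc : npc_combination D comb.
Hypothesis K_convex : convex_set comb K.

Lemma minimizing_dist (m e : R) (v a b : Y) : 0 <= m -> 0 <= e <= 1 ->
  (forall z, K z -> m <= D v z) -> K a -> K b -> D v a <= m + e -> D v b <= m + e ->
  D a b ^ 2 <= 4 * (2 * m + 1) * e.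
Proof.
  intros Hm He Hmin Ka Kb Ha Hb.
  pose proof (Hmin _ (K_convex (1 / 2) a b ltac:(lra) Ka Kb)) as Hmid.
  pose proof (comb_npc (1 / 2) a b v ltac:(lra)) as Hnpc.
  assert (m ^ 2 <= D v (comb (1 / 2) a b) ^ 2) by (apply pow_incr; lra).
  assert (D v a ^ 2 <= (m + e) ^ 2) by (apply pow_incr; pose proof (Hmin a Ka); lra).
  assert (D v b ^ 2 <= (m + e) ^ 2) by (apply pow_incr; pose proof (Hmin b Kb); lra).
  nra.
Qed.

Lemma minimizing_seq_cauchy (m : R) (v : Y) (u : nat -> Y) : 0 <= m ->
  (forall z, K z -> m <= D v z) -> (forall n, K (u n)) ->
  (forall e, 0 < e -> exists N, forall n, (N <= n)%nat -> D v (u n) <= m + e) ->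
  cauchy_seq D u.
Proof.
  intros Hm Hmin Hu Hnear e He. set (c := 4 * (2 * m + 1)). set (e' := Rmin 1 (e ^ 2 / (2 * c))).
  assert (Hq : 0 < e ^ 2 / (2 * c)) by (apply Rdiv_lt_0_compat; unfold c; nra).
  assert (He' : 0 < e' <= 1) by (split; [apply Rmin_glb_lt; lra|apply Rmin_l]).
  assert (Hsmall : c * e' < e ^ 2).
  { assert (e' * (2 * c) <= e ^ 2) by (apply Rle_div_r; [unfold c; lra|apply Rmin_r]).
    assert (0 < e ^ 2) by (apply pow_lt; lra). lra. }
  destruct (Hnear e' ltac:(lra)) as [N HN]. exists N. intros i j Hi Hj.
  apply pow2_lt_reg; [lra|]. apply Rle_lt_trans with (2 := Hsmall).
  apply minimizing_dist with v; auto; lra.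
Qed.

Lemma minimizer_exists (v : Y) : (exists z, K z) -> complete_set D K ->
  exists l, K l /\ forall z, K z -> D v l <= D v z.
Proof.
  intros Hne Hcomp.
  destruct (infimum_approached K (D v) 0 Hne) as [m [Hmin Happr]].
  { intros z _. apply (pdist_ge0 D_pm). }
  assert (Hm : 0 <= m).
  { apply Rle_plus_epsilon. intros e He. destruct (Happr e He) as [z [_ Hz]].
    pose proof (pdist_ge0 D_pm v z). lra. }
  set (u := fun n => epsilon (inhabits v) (fun z => K z /\ D v z < m + 1 / 2 ^ n)).
  assert (Hu : forall n, K (u n) /\ D v (u n) < m + 1 / 2 ^ n).
  { intros n. apply epsilon_spec. apply Happr, div_pow2_pos. lra. }
  destruct (Hcomp u (fun n => proj1 (Hu n))) as [l [Kl Hl]].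
  - apply (minimizing_seq_cauchy m v u Hm Hmin (fun n => proj1 (Hu n))).
    intros e He. destruct (div_pow2_lt 1 e He) as [N HN]. exists N. intros n Hn.
    specialize (HN n Hn). pose proof (proj2 (Hu n)). lra.
  - exists l. split; [exact Kl|]. intros z Hz. apply Rle_trans with (2 := Hmin z Hz).
    apply (is_lim_seq_le (fun n => D v (u n)) (fun n => m + 1 / 2 ^ n) (D v l) m).
    + intros n. left. apply Hu.
    + apply dist_is_lim_seq; [apply converges_to_const|exact Hl].
    + replace (Finite m) with (Finite (m + 0)) by (f_equal; ring).
      apply is_lim_seq_plus'; [apply is_lim_seq_const|apply is_lim_seq_div_pow2].
Qed.

(* Compare the minimizer [l] with the points near it on the segment from [l] to [z]. *)
Lemma minimizer_angle (v l z : Y) : K l -> (forall z, K z -> D v l <= D v z) -> K z ->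
  D v l ^ 2 + D l z ^ 2 <= D v z ^ 2.
Proof.
  intros Kl Hmin Kz.
  enough (H : forall e, 0 < e < 1 -> D v l ^ 2 + (1 - e) * D l z ^ 2 <= D v z ^ 2).
  { apply Rle_plus_epsilon. intros eps Heps.
    pose proof (pow2_ge_0 (D l z)) as Hq.
    set (e := Rmin (1 / 2) (eps / (D l z ^ 2 + 1))).
    assert (He : 0 < e <= 1 / 2).
    { split; [apply Rmin_glb_lt; [lra|apply Rdiv_lt_0_compat; lra]|apply Rmin_l]. }
    assert (e * (D l z ^ 2 + 1) <= eps) by (apply Rle_div_r; [lra|apply Rmin_r]).
    specialize (H e ltac:(lra)). nra. }
  intros e He.
  pose proof (Hmin _ (K_convex e l z ltac:(lra) Kl Kz)) as Hle.
  pose proof (comb_npc e l z v ltac:(lra)) as Hnpc.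
  assert (D v l ^ 2 <= D v (comb e l z) ^ 2).
  { apply pow_incr. split; [apply (pdist_ge0 D_pm)|exact Hle]. }
  apply Rmult_le_reg_l with e; [lra|]. nra.
Qed.

Lemma nearest_is_projection : (exists z, K z) -> complete_set D K ->
  is_projection D K (nearest D K).
Proof.
  intros Hne Hcomp v.
  destruct (epsilon_spec (inhabits v) _ (minimizer_exists v Hne Hcomp)) as [Kl Hmin].
  split; [exact Kl|]. intros z Hz. apply minimizer_angle; auto.
Qed.

End Projection.

Section ProjectionMap.

Context (comb : R -> Y -> Y -> Y) (K : Y -> Prop) (P : Y -> Y).
Hypothesis comb_npc : npc_combination D comb.
Hypothesis P_proj : is_projection D K P.

Lemma projection_dist_le (v z : Y) : K z -> D v (P v) <= D v z.
Proof.
  intros Hz. apply pow2_le_reg; [apply (pdist_ge0 D_pm)|].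
  pose proof (proj2 (P_proj v) z Hz). pose proof (pow2_ge_0 (D (P v) z)). lra.
Qed.

Lemma projection_toward (v z : Y) : K z -> D (P v) z <= D v z.
Proof.
  intros Hz. apply pow2_le_reg; [apply (pdist_ge0 D_pm)|].
  pose proof (proj2 (P_proj v) z Hz). pose proof (pow2_ge_0 (D v (P v))). lra.
Qed.

Lemma projection_short (v w : Y) : D (P v) (P w) <= D v w.
Proof.
  pose proof (proj2 (P_proj v) _ (proj1 (P_proj w))) as Hv.
  pose proof (proj2 (P_proj w) _ (proj1 (P_proj v))) as Hw.
  pose proof (quadrilateral comb v w (P w) (P v) comb_npc) as H.
  rewrite (pdist_sym D_pm (P w) (P v)) in Hw, H. rewrite (pdist_sym D_pm (P v) v) in H.
  pose proof (pdist_ge0 D_pm (P v) (P w)). pose proof (pdist_ge0 D_pm v w). nra.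
Qed.

Lemma projection_dist_lipschitz (v w : Y) : D v (P v) <= D w (P w) + D v w.
Proof.
  pose proof (projection_dist_le v (P w) (proj1 (P_proj w))).
  pose proof (pdist_triangle D_pm v w (P w)). lra.
Qed.

Lemma projection_dist_convex (t : R) (v w : Y) : convex_set comb K -> 0 <= t <= 1 ->
  D (comb t v w) (P (comb t v w)) <= (1 - t) * D v (P v) + t * D w (P w).
Proof.
  intros Hconv Ht. apply Rle_trans with (2 := comb_dist comb t v (P v) w (P w) comb_npc Ht).
  apply projection_dist_le. apply Hconv; [exact Ht|apply P_proj..].
Qed.

(* Although [b] need not lie in [K], replacing [a] by its projection increases the
   distance to [b] only to second order in the distances to [K]. *)
Lemma projection_almost_toward (a b : Y) :
  D b (P a) ^ 2 <= D a b ^ 2 + 2 * D a (P a) * D b (P b).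
Proof.
  pose proof (proj2 (P_proj a) _ (proj1 (P_proj b))) as Ha.
  pose proof (quadrilateral comb b (P b) (P a) a comb_npc) as H.
  rewrite (pdist_sym D_pm (P b) (P a)), (pdist_sym D_pm (P b) a), (pdist_sym D_pm (P a) a) in H.
  pose proof (pow2_ge_0 (D a (P a))). lra.
Qed.

End ProjectionMap.

(** * Sweeping by a decreasing family of convex sets *)

Section Sweeping.

Context (comb : R -> Y -> Y -> Y) (K : R -> Y -> Prop) (P : R -> Y -> Y) (o : Y) (T C : R).
Hypothesis comb_npc : npc_combination D comb.
Hypothesis T_ge0 : 0 <= T.
Hypothesis C_ge0 : 0 <= C.
Hypothesis K_decr : forall s t v, 0 <= s -> s <= t -> t <= T -> K t v -> K s v.
Hypothesis P_proj : forall t, 0 <= t <= T -> is_projection D (K t) (P t).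
Hypothesis P_pythagoras : forall t v, 0 <= t <= T ->
  D (P t v) o ^ 2 + D v (P t v) ^ 2 = D v o ^ 2.
Hypothesis P_speed : forall s t v, 0 <= s -> s <= t -> t <= T ->
  K s v -> D v (P t v) <= C * (t - s) * D v o.

Fixpoint sweep (h : R) (n : nat) (v : Y) : Y :=
  match n with
  | O => v
  | S n => P (h * INR (S n)) (sweep h n v)
  end.

Lemma step_time (h : R) (n : nat) : 0 <= h -> h * INR (S n) <= T ->
  0 <= h * INR n /\ h * INR n <= h * INR (S n) /\ h * INR (S n) - h * INR n = h.
Proof. intros Hh. rewrite S_INR. pose proof (pos_INR n). nra. Qed.

Lemma sweep_in (h : R) (n : nat) (v : Y) : 0 <= h -> h * INR n <= T ->
  K 0 v -> K (h * INR n) (sweep h n v).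
Proof.
  intros Hh Hn Hv. destruct n as [|n].
  - simpl. rewrite Rmult_0_r. exact Hv.
  - destruct (step_time h n Hh Hn) as [Hstart [Hstep _]]. apply P_proj. lra.
Qed.

Lemma sweep_norm_le (h : R) (n : nat) (v : Y) : 0 <= h -> h * INR n <= T ->
  D (sweep h n v) o <= D v o.
Proof.
  intros Hh Hn. induction n as [|n IH]; [simpl; lra|].
  destruct (step_time h n Hh Hn) as [Hstart [Hstep _]]. cbn [sweep].
  apply Rle_trans with (2 := IH ltac:(lra)).
  apply pow2_le_reg; [apply (pdist_ge0 D_pm)|].
  pose proof (P_pythagoras (h * INR (S n)) (sweep h n v) ltac:(lra)).
  pose proof (pow2_ge_0 (D (sweep h n v) (P (h * INR (S n)) (sweep h n v)))). lra.
Qed.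

Lemma step_dist (h : R) (n : nat) (v a : Y) : 0 <= h -> h * INR (S n) <= T ->
  K (h * INR n) a -> D a o <= D v o -> D a (P (h * INR (S n)) a) <= C * h * D v o.
Proof.
  intros Hh Hn Ka Ha. destruct (step_time h n Hh Hn) as [Hstart [Hstep Hlen]].
  pose proof (P_speed (h * INR n) (h * INR (S n)) a Hstart Hstep Hn Ka) as H. rewrite Hlen in H.
  apply Rle_trans with (1 := H). apply Rmult_le_compat_l; nra.
Qed.

Lemma sweep_norm_ge (h : R) (n : nat) (v : Y) : 0 <= h -> h * INR n <= T -> K 0 v ->
  D v o ^ 2 - INR n * (C * h * D v o) ^ 2 <= D (sweep h n v) o ^ 2.
Proof.
  intros Hh Hn Hv. induction n as [|n IH]; [simpl; lra|].
  destruct (step_time h n Hh Hn) as [Hstart [Hstep _]]. specialize (IH ltac:(lra)). cbn [sweep].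
  pose proof (step_dist h n v (sweep h n v) Hh Hn (sweep_in h n v Hh ltac:(lra) Hv)
    (sweep_norm_le h n v Hh ltac:(lra))) as Hs.
  set (a := sweep h n v) in *.
  assert (D a (P (h * INR (S n)) a) ^ 2 <= (C * h * D v o) ^ 2).
  { apply pow_incr. split; [apply (pdist_ge0 D_pm)|exact Hs]. }
  pose proof (P_pythagoras (h * INR (S n)) a ltac:(lra)).
  rewrite S_INR in *. lra.
Qed.

Lemma sweep_short (h : R) (n : nat) (v w : Y) : 0 <= h -> h * INR n <= T ->
  D (sweep h n v) (sweep h n w) <= D v w.
Proof.
  intros Hh Hn. induction n as [|n IH]; [simpl; lra|].
  destruct (step_time h n Hh Hn) as [Hstart [Hstep _]]. cbn [sweep].
  apply Rle_trans with (2 := IH ltac:(lra)).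
  apply (projection_short comb (K (h * INR (S n)))); [exact comb_npc|apply P_proj; lra].
Qed.

Lemma sweep_toward (h : R) (n k : nat) (v z : Y) : 0 <= h -> h * INR (n + k) <= T ->
  K (h * INR (n + k)) z -> D (sweep h (n + k) v) z <= D (sweep h n v) z.
Proof.
  intros Hh Hn Hz. induction k as [|k IH]; [rewrite Nat.add_0_r; lra|].
  rewrite Nat.add_succ_r in *. cbn [sweep].
  destruct (step_time h (n + k) Hh Hn) as [Hstart [Hstep _]].
  apply Rle_trans with (D (sweep h (n + k) v) z).
  - apply (projection_toward (K (h * INR (S (n + k))))); [apply P_proj; lra|exact Hz].
  - apply IH; [lra|]. apply K_decr with (3 := Hn); auto.
Qed.

Lemma sweep_fix (h : R) (n : nat) (v : Y) : 0 <= h -> h * INR n <= T ->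
  K T v -> D (sweep h n v) v = 0.
Proof.
  intros Hh Hn Hv. apply Rle_antisym; [|apply (pdist_ge0 D_pm)].
  rewrite <- (pdist_refl D_pm v). apply (sweep_toward h 0 n v v Hh Hn).
  apply K_decr with T; auto with real. apply Rmult_le_pos; [exact Hh|apply pos_INR].
Qed.

Lemma step_almost_toward (h : R) (n : nat) (v a b : Y) : 0 <= h -> h * INR (S n) <= T ->
  K (h * INR n) a -> D a o <= D v o -> K (h * INR n) b -> D b o <= D v o ->
  D b (P (h * INR (S n)) a) ^ 2 <= D a b ^ 2 + 2 * (C * h * D v o) ^ 2.
Proof.
  intros Hh Hn Ka Ha Kb Hb. destruct (step_time h n Hh Hn) as [Hstart [Hstep _]].
  pose proof (step_dist h n v a Hh Hn Ka Ha) as Sa.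
  pose proof (step_dist h n v b Hh Hn Kb Hb) as Sb.
  set (t := h * INR (S n)) in *.
  pose proof (projection_almost_toward comb (K t) (P t) comb_npc (P_proj t ltac:(lra)) a b).
  assert (D a (P t a) * D b (P t b) <= (C * h * D v o) * (C * h * D v o))
    by (apply Rmult_le_compat; auto; apply (pdist_ge0 D_pm)).
  lra.
Qed.

(* All the finer steps inside one step of length [h] move towards its end point, which
   lies in every set swept meanwhile. *)
Lemma sweep_refine (h : R) (k n : nat) (v : Y) : 0 <= h -> h * INR n <= T ->
  (0 < k)%nat -> K 0 v ->
  D (sweep h n v) (sweep (h / INR k) (n * k) v) ^ 2 <= INR n * (2 * (C * h * D v o) ^ 2).
Proof.
  intros Hh Hn Hk Hv.
  assert (Hk0 : 0 < INR k) by (apply lt_0_INR; lia).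
  assert (Hhk : 0 <= h / INR k) by (apply Rle_mult_inv_pos; lra).
  assert (Etime : forall i, h / INR k * INR (i * k) = h * INR i).
  { intros i. rewrite mult_INR. field. lra. }
  induction n as [|n IH]; [simpl; rewrite (pdist_refl D_pm); lra|].
  destruct (step_time h n Hh Hn) as [Hstart [Hstep _]]. specialize (IH ltac:(lra)).
  assert (Hend : D (sweep (h / INR k) (S n * k) v) (sweep h (S n) v)
      <= D (sweep (h / INR k) (n * k) v) (sweep h (S n) v)).
  { replace (S n * k)%nat with (n * k + k)%nat by (simpl; lia).
    apply sweep_toward; [exact Hhk|..];
      replace (n * k + k)%nat with (S n * k)%nat by (simpl; lia); rewrite Etime; [exact Hn|].
    apply sweep_in; auto. }
  assert (Hab : D (sweep (h / INR k) (n * k) v) (sweep h (S n) v) ^ 2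
      <= D (sweep h n v) (sweep (h / INR k) (n * k) v) ^ 2 + 2 * (C * h * D v o) ^ 2).
  { apply step_almost_toward; [exact Hh|exact Hn|apply sweep_in|apply sweep_norm_le
      |rewrite <- Etime; apply sweep_in|apply sweep_norm_le]; rewrite ?Etime; auto; lra. }
  rewrite (pdist_sym D_pm (sweep h (S n) v)).
  apply (conj (pdist_ge0 D_pm _ _)), (pow_incr _ _ 2) in Hend.
  rewrite S_INR. lra.
Qed.

Definition dyadic_sweep (v : Y) (m : nat) : Y := sweep (T / 2 ^ m) (2 ^ m) v.

Lemma dyadic_time (m : nat) : 0 <= T / 2 ^ m /\ T / 2 ^ m * INR (2 ^ m) = T.
Proof.
  assert (H : 0 < 2 ^ m) by (apply pow_lt; lra). split.
  - apply Rle_mult_inv_pos; lra.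
  - rewrite INR_pow2. field. lra.
Qed.

Lemma dyadic_sweep_refine (v : Y) (m j : nat) : K 0 v ->
  D (dyadic_sweep v m) (dyadic_sweep v (m + j)) ^ 2 <= 2 * (C * T * D v o) ^ 2 / 2 ^ m.
Proof.
  intros Hv. destruct (dyadic_time m) as [Hstep Htotal].
  pose proof (sweep_refine (T / 2 ^ m) (2 ^ j) (2 ^ m) v Hstep ltac:(lra)
    ltac:(apply Nat.neq_0_lt_0, Nat.pow_nonzero; lia) Hv) as H.
  assert (0 < 2 ^ m) by (apply pow_lt; lra). assert (0 < 2 ^ j) by (apply pow_lt; lra).
  rewrite <- Nat.pow_add_r, !INR_pow2 in H.
  replace (T / 2 ^ m / 2 ^ j) with (T / 2 ^ (m + j)) in H by (rewrite pow_add; field; lra).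
  apply Rle_trans with (1 := H). right. field. lra.
Qed.

Lemma dyadic_sweep_cauchy (v : Y) : K 0 v -> cauchy_seq D (dyadic_sweep v).
Proof.
  intros Hv e He.
  destruct (div_pow2_lt (2 * (C * T * D v o) ^ 2) ((e / 2) ^ 2)) as [N HN]; [nra|].
  exists N.
  assert (Hfar : forall m, (N <= m)%nat -> D (dyadic_sweep v N) (dyadic_sweep v m) < e / 2).
  { intros m Hm. apply pow2_lt_reg; [lra|].
    replace m with (N + (m - N))%nat by lia.
    apply Rle_lt_trans with (1 := dyadic_sweep_refine v N (m - N) Hv). apply HN. lia. }
  intros i j Hi Hj. pose proof (Hfar i Hi). pose proof (Hfar j Hj).
  pose proof (pdist_triangle D_pm (dyadic_sweep v i) (dyadic_sweep v N) (dyadic_sweep v j)).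
  rewrite (pdist_sym D_pm (dyadic_sweep v i) (dyadic_sweep v N)) in *. lra.
Qed.

Definition sweep_limit (v : Y) : Y :=
  epsilon (inhabits v) (fun l => K T l /\ converges_to D (dyadic_sweep v) l).

Hypothesis KT_complete : complete_set D (K T).

Lemma sweep_limit_spec (v : Y) : K 0 v ->
  K T (sweep_limit v) /\ converges_to D (dyadic_sweep v) (sweep_limit v).
Proof.
  intros Hv. unfold sweep_limit. apply epsilon_spec. apply KT_complete.
  - intros m. destruct (dyadic_time m) as [Hstep Htotal]. rewrite <- Htotal at 1.
    apply sweep_in; auto. lra.
  - apply dyadic_sweep_cauchy; auto.
Qed.

Lemma sweep_limit_short (v w : Y) : K 0 v -> K 0 w ->
  D (sweep_limit v) (sweep_limit w) <= D v w.
Proof.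
  intros Hv Hw.
  apply (dist_lim_le (dyadic_sweep v) (dyadic_sweep w)); [apply sweep_limit_spec; auto..|].
  intros m. destruct (dyadic_time m) as [Hstep Htotal]. apply sweep_short; lra.
Qed.

Lemma sweep_limit_fix (v : Y) : K 0 v -> K T v -> D (sweep_limit v) v = 0.
Proof.
  intros Hv HTv. apply Rle_antisym; [|apply (pdist_ge0 D_pm)].
  apply (dist_lim_le (dyadic_sweep v) (fun _ => v));
    [apply sweep_limit_spec; auto|apply converges_to_const|].
  intros m. destruct (dyadic_time m) as [Hstep Htotal]. right. apply sweep_fix; auto. lra.
Qed.

Lemma sweep_limit_norm (v : Y) : K 0 v -> D (sweep_limit v) o = D v o.
Proof.
  intros Hv. pose proof (proj2 (sweep_limit_spec v Hv)) as Hlim.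
  apply Rle_antisym.
  - apply (dist_lim_le (dyadic_sweep v) (fun _ => o)); [exact Hlim|apply converges_to_const|].
    intros m. destruct (dyadic_time m) as [Hstep Htotal]. apply sweep_norm_le; lra.
  - apply pow2_le_reg; [apply (pdist_ge0 D_pm)|]. rewrite <- (Rminus_0_r (D v o ^ 2)).
    apply (is_lim_seq_le (fun m => D v o ^ 2 - (C * T * D v o) ^ 2 / 2 ^ m)
      (fun m => D (dyadic_sweep v m) o ^ 2)
      (D v o ^ 2 - 0) (D (sweep_limit v) o ^ 2)).
    + intros m. destruct (dyadic_time m) as [Hstep Htotal].
      apply Rle_trans with (2 := sweep_norm_ge (T / 2 ^ m) (2 ^ m) v Hstep ltac:(lra) Hv).
      right. rewrite INR_pow2. field. apply pow_nonzero. lra.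
    + apply is_lim_seq_minus'; [apply is_lim_seq_const|apply is_lim_seq_div_pow2].
    + simpl. pose proof (dist_is_lim_seq _ (fun _ => o) _ _ Hlim (converges_to_const o)) as H.
      apply is_lim_seq_mult'; [exact H|]. apply is_lim_seq_mult'; [exact H|].
      apply is_lim_seq_const.
Qed.

Theorem sweep_retraction_exists : exists F : Y -> Y,
  (forall v, K 0 v -> K T (F v) /\ D (F v) o = D v o) /\
  (forall v w, K 0 v -> K 0 w -> D (F v) (F w) <= D v w) /\
  (forall v, K T v -> D (F v) v = 0).
Proof.
  exists sweep_limit. split; [|split].
  - intros v Hv. split; [apply sweep_limit_spec|apply sweep_limit_norm]; exact Hv.
  - exact sweep_limit_short.
  - intros v Hv. apply sweep_limit_fix; [|exact Hv]. apply K_decr with T; auto with real.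
Qed.

End Sweeping.

End Pseudometric.

(** * Euclidean cones *)

(* Points of radius [0] are not identified: they all represent the apex, at distance [0]. *)
Record cone (Z : Type) : Type := ConePoint {
  rad : R;
  dir : Z;
  rad_ge0 : 0 <= rad }.

Arguments ConePoint {Z}.
Arguments rad {Z}.
Arguments dir {Z}.
Arguments rad_ge0 {Z}.

(* [Rabs] only makes scaling total; it is used with [0 <= l]. *)
Definition cone_scale {Z : Type} (l : R) (v : cone Z) : cone Z :=
  ConePoint (Rabs l * rad v) (dir v) (Rmult_le_pos _ _ (Rabs_pos l) (rad_ge0 v)).

Definition cone_apex {Z : Type} (x : Z) : cone Z := ConePoint 0 x (Rle_refl 0).

Definition cone_unit {Z : Type} (x : Z) : cone Z := ConePoint 1 x Rle_0_1.

Definition cone_over {Z : Type} (A : Z -> Prop) (v : cone Z) : Prop := A (dir v).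

Definition conical {Z : Type} (K : cone Z -> Prop) : Prop :=
  forall l v, 0 <= l -> K v -> K (cone_scale l v).

Definition cone_ip {Z : Type} (d : Z -> Z -> R) (v w : cone Z) : R :=
  rad v * rad w * cos (d (dir v) (dir w)).

Definition cone_dist {Z : Type} (d : Z -> Z -> R) (v w : cone Z) : R :=
  sqrt (rad v ^ 2 + rad w ^ 2 - 2 * cone_ip d v w).

(* A vector sum [u] of [v] and [w]; superadditivity is all that remains of the
   bilinearity of the inner product. *)
Definition is_cone_sum {Z : Type} (d : Z -> Z -> R) (v w u : cone Z) : Prop :=
  rad u ^ 2 <= rad v ^ 2 + rad w ^ 2 + 2 * cone_ip d v w /\
  forall z, cone_ip d z v + cone_ip d z w <= cone_ip d z u.

Definition has_cone_sums {Z : Type} (d : Z -> Z -> R) (A : Z -> Prop) : Prop :=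
  forall v w : cone Z, exists u, is_cone_sum d v w u /\
    (cone_over A v -> cone_over A w -> cone_over A u).

Definition cone_sum {Z : Type} (d : Z -> Z -> R) (A : Z -> Prop) (v w : cone Z) : cone Z :=
  epsilon (inhabits v) (fun u => is_cone_sum d v w u /\
    (cone_over A v -> cone_over A w -> cone_over A u)).

Definition cone_comb {Z : Type} (d : Z -> Z -> R) (A : Z -> Prop)
    (t : R) (v w : cone Z) : cone Z :=
  cone_sum d A (cone_scale (1 - t) v) (cone_scale t w).

Lemma dist_euc_polar (r s a b : R) :
  dist_euc (r * cos a) (r * sin a) (s * cos b) (s * sin b)
    = sqrt (r ^ 2 + s ^ 2 - 2 * (r * s * cos (a - b))).
Proof.
  unfold dist_euc. f_equal. rewrite cos_minus.
  pose proof (sin2_cos2 a) as Ha. pose proof (sin2_cos2 b) as Hb. unfold Rsqr in *.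
  replace (r ^ 2) with (r ^ 2 * (sin a * sin a + cos a * cos a)) by (rewrite Ha; ring).
  replace (s ^ 2) with (s ^ 2 * (sin b * sin b + cos b * cos b)) by (rewrite Hb; ring).
  ring.
Qed.

Lemma one_minus_cos_le (x : R) : 0 <= x <= PI -> 1 - cos x <= x ^ 2 / 2.
Proof.
  intros Hx. replace (cos x) with (cos (2 * (x / 2))) by (f_equal; field).
  rewrite cos_2a_sin.
  assert (0 <= sin (x / 2)) by (apply sin_ge_0; lra).
  assert (sin (x / 2) <= x / 2).
  { destruct (proj1 Hx) as [Hpos|<-].
    - left. apply sin_lt_x. lra.
    - replace (0 / 2) with 0 by field. rewrite sin_0. lra. }
  nra.
Qed.

Section ConeMetric.

Context {Z : Type} {d : Z -> Z -> R} (d_pm : is_pseudometric d).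
Hypothesis d_le_PI : forall x y, d x y <= PI.

Lemma cone_ip_sym (v w : cone Z) : cone_ip d v w = cone_ip d w v.
Proof. unfold cone_ip. rewrite (pdist_sym d_pm). ring. Qed.

Lemma cone_ip_diag (v : cone Z) : cone_ip d v v = rad v ^ 2.
Proof. unfold cone_ip. rewrite (pdist_refl d_pm), cos_0. ring. Qed.

Lemma cone_ip_apex (v : cone Z) (x : Z) : cone_ip d v (cone_apex x) = 0.
Proof. unfold cone_ip. simpl. ring. Qed.

Lemma cone_ip_scale_r (l : R) (v w : cone Z) : 0 <= l ->
  cone_ip d v (cone_scale l w) = l * cone_ip d v w.
Proof. intros Hl. unfold cone_ip. simpl. rewrite Rabs_pos_eq by exact Hl. ring. Qed.

Lemma cone_ip_scale_l (l : R) (v w : cone Z) : 0 <= l ->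
  cone_ip d (cone_scale l v) w = l * cone_ip d v w.
Proof. intros Hl. unfold cone_ip. simpl. rewrite Rabs_pos_eq by exact Hl. ring. Qed.

Lemma rad_scale (l : R) (v : cone Z) : 0 <= l -> rad (cone_scale l v) = l * rad v.
Proof. intros Hl. simpl. rewrite Rabs_pos_eq by exact Hl. reflexivity. Qed.

Lemma cone_dist_sqr_polar (v w : cone Z) :
  rad v ^ 2 + rad w ^ 2 - 2 * cone_ip d v w
    = (rad v - rad w) ^ 2 + 2 * (rad v * rad w) * (1 - cos (d (dir v) (dir w))).
Proof. unfold cone_ip. ring. Qed.

Lemma cone_angular_ge0 (v w : cone Z) :
  0 <= 2 * (rad v * rad w) * (1 - cos (d (dir v) (dir w))).
Proof.
  pose proof (COS_bound (d (dir v) (dir w))).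
  pose proof (Rmult_le_pos _ _ (rad_ge0 v) (rad_ge0 w)). nra.
Qed.

Lemma cone_dist_sqr (v w : cone Z) :
  cone_dist d v w ^ 2 = rad v ^ 2 + rad w ^ 2 - 2 * cone_ip d v w.
Proof.
  apply pow2_sqrt. rewrite cone_dist_sqr_polar.
  pose proof (cone_angular_ge0 v w). pose proof (pow2_ge_0 (rad v - rad w)). lra.
Qed.

Lemma cone_dist_apex (v : cone Z) (x : Z) : cone_dist d v (cone_apex x) = rad v.
Proof.
  unfold cone_dist. rewrite cone_ip_apex. simpl rad.
  replace (rad v ^ 2 + 0 ^ 2 - 2 * 0) with (rad v ^ 2) by ring. apply sqrt_pow2, rad_ge0.
Qed.

Lemma cone_dist_scale (l : R) (v w : cone Z) : 0 <= l ->
  cone_dist d (cone_scale l v) (cone_scale l w) = l * cone_dist d v w.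
Proof.
  intros Hl. rewrite <- (sqrt_pow2 l Hl) at 3. unfold cone_dist.
  rewrite <- sqrt_mult_alt by apply pow2_ge_0. f_equal.
  rewrite cone_ip_scale_l, cone_ip_scale_r, !rad_scale by exact Hl. ring.
Qed.

(* Lay the directions of [u], [v], [w] out in the plane at angles [a], [0], [- b]. *)
Lemma cone_dist_triangle (u v w : cone Z) : cone_dist d u w <= cone_dist d u v + cone_dist d v w.
Proof.
  pose proof PI_RGT_0.
  set (a := d (dir u) (dir v)). set (b := Rmin (d (dir v) (dir w)) (PI - a)).
  assert (Ha : 0 <= a <= PI) by (split; [apply (pdist_ge0 d_pm)|apply d_le_PI]).
  assert (Hb : 0 <= b <= PI - a).
  { split; [apply Rmin_glb; [apply (pdist_ge0 d_pm)|lra]|apply Rmin_r]. }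
  assert (Huw : cos (a + b) <= cos (d (dir u) (dir w))).
  { apply cos_decr_1; try lra; try apply (pdist_ge0 d_pm); try apply d_le_PI.
    pose proof (pdist_triangle d_pm (dir u) (dir v) (dir w)) as Huvw. fold a in Huvw.
    pose proof (d_le_PI (dir u) (dir w)). unfold b. apply Rmin_case; lra. }
  assert (Hvw : cos (d (dir v) (dir w)) <= cos b).
  { apply cos_decr_1; try lra; try apply d_le_PI; [|apply Rmin_l].
    apply (pdist_ge0 d_pm). }
  pose proof (triangle (rad u * cos a) (rad u * sin a) (rad w * cos (- b)) (rad w * sin (- b))
    (rad v * cos 0) (rad v * sin 0)) as Htri.
  rewrite !dist_euc_polar in Htri.
  replace (a - - b) with (a + b) in Htri by ring. replace (0 - - b) with b in Htri by ring.
  rewrite Rminus_0_r in Htri.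
  pose proof (Rmult_le_pos _ _ (rad_ge0 u) (rad_ge0 w)) as Ruw.
  pose proof (Rmult_le_pos _ _ (rad_ge0 v) (rad_ge0 w)) as Rvw.
  unfold cone_dist at 1 3. unfold cone_ip.
  apply Rle_trans with (sqrt (rad u ^ 2 + rad w ^ 2 - 2 * (rad u * rad w * cos (a + b)))).
  { apply sqrt_le_1_alt. nra. }
  apply Rle_trans with (1 := Htri). apply Rplus_le_compat.
  - right. reflexivity.
  - apply sqrt_le_1_alt. nra.
Qed.

Lemma cone_dist_pseudometric : is_pseudometric (cone_dist d).
Proof.
  split.
  - intros v w. apply sqrt_pos.
  - intros v. unfold cone_dist. rewrite cone_ip_diag, <- sqrt_0. f_equal. ring.
  - intros v w. unfold cone_dist. rewrite cone_ip_sym. f_equal. ring.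
  - apply cone_dist_triangle.
Qed.

Lemma rad_dist_le (v w : cone Z) : Rabs (rad v - rad w) <= cone_dist d v w.
Proof.
  apply pow2_le_reg; [apply sqrt_pos|].
  rewrite pow2_abs, cone_dist_sqr, cone_dist_sqr_polar.
  pose proof (cone_angular_ge0 v w). lra.
Qed.

Lemma cone_dist_le (v w : cone Z) :
  cone_dist d v w <= Rabs (rad v - rad w) + rad w * d (dir v) (dir w).
Proof.
  set (m := ConePoint (rad w) (dir v) (rad_ge0 w)).
  apply Rle_trans with (1 := cone_dist_triangle v m w). apply Rplus_le_compat.
  - apply pow2_le_reg; [apply Rabs_pos|].
    rewrite pow2_abs, cone_dist_sqr, cone_dist_sqr_polar.
    simpl dir. simpl rad. rewrite (pdist_refl d_pm), cos_0. lra.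
  - pose proof (rad_ge0 w). pose proof (pdist_ge0 d_pm (dir v) (dir w)).
    apply pow2_le_reg; [nra|]. rewrite cone_dist_sqr, cone_dist_sqr_polar. simpl dir. simpl rad.
    pose proof (one_minus_cos_le (d (dir v) (dir w)) ltac:(auto)). nra.
Qed.

Lemma cone_dist_unit_sqr (x y : Z) :
  cone_dist d (cone_unit x) (cone_unit y) ^ 2 = 2 - 2 * cos (d x y).
Proof. rewrite cone_dist_sqr. unfold cone_ip. simpl. ring. Qed.

Lemma dir_dist_le_of_unit (v w : cone Z) (x y : Z) : rad v = 1 -> rad w = 1 ->
  cone_dist d v w <= cone_dist d (cone_unit x) (cone_unit y) ->
  d (dir v) (dir w) <= d x y.
Proof.
  intros Hv Hw Hle. pose proof PI_RGT_0.
  assert (Hsq : cone_dist d v w ^ 2 <= cone_dist d (cone_unit x) (cone_unit y) ^ 2).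
  { apply pow_incr. split; [apply sqrt_pos|exact Hle]. }
  rewrite cone_dist_unit_sqr, cone_dist_sqr in Hsq. unfold cone_ip in Hsq.
  rewrite Hv, Hw in Hsq.
  destruct (Rle_or_lt (d (dir v) (dir w)) (d x y)) as [|Hlt]; [assumption|exfalso].
  assert (cos (d (dir v) (dir w)) < cos (d x y)).
  { apply cos_decreasing_1; auto; apply (pdist_ge0 d_pm). }
  lra.
Qed.

Lemma rad_converges (u : nat -> cone Z) : cauchy_seq (cone_dist d) u ->
  exists r, 0 <= r /\ Un_cv (fun n => rad (u n)) r.
Proof.
  intros Hc. destruct (Rcomplete.R_complete (fun n => rad (u n))) as [r Hr].
  - intros e He. destruct (Hc e He) as [N HN]. exists N. intros m n Hm Hn.
    apply Rle_lt_trans with (1 := rad_dist_le (u m) (u n)). auto.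
  - exists r. split; [|exact Hr].
    apply (is_lim_seq_le (fun _ => 0) (fun n => rad (u n)) 0 r).
    + intros n. apply rad_ge0.
    + apply is_lim_seq_const.
    + apply is_lim_seq_Reals, Hr.
Qed.

Lemma dir_cauchy (u : nat -> cone Z) (r : R) : 0 < r ->
  (exists N, forall n, (N <= n)%nat -> r <= rad (u n)) ->
  cauchy_seq (cone_dist d) u -> cauchy_seq d (fun n => dir (u n)).
Proof.
  intros Hr [N0 Hrad] Hc e He. pose proof PI_RGT_0.
  set (e' := Rmin e PI).
  assert (He' : 0 < e' <= PI) by (split; [apply Rmin_glb_lt; lra|apply Rmin_r]).
  assert (Hcos : 0 < 1 - cos e').
  { assert (cos e' < cos 0) by (apply cos_decreasing_1; lra). rewrite cos_0 in *. lra. }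
  set (q := 2 * (r * r) * (1 - cos e')).
  assert (Hq : 0 < q) by (unfold q; repeat apply Rmult_lt_0_compat; lra).
  destruct (Hc (sqrt q) (sqrt_lt_R0 _ Hq)) as [N HN].
  exists (max N0 N). intros m n Hm Hn.
  apply Rlt_le_trans with e'; [|apply Rmin_l].
  destruct (Rlt_or_le (d (dir (u m)) (dir (u n))) e') as [|Hge]; [assumption|exfalso].
  assert (cos (d (dir (u m)) (dir (u n))) <= cos e').
  { apply cos_decr_1; auto; lra. }
  specialize (HN m n ltac:(lia) ltac:(lia)).
  assert (Hlt : cone_dist d (u m) (u n) ^ 2 < q).
  { rewrite <- (pow2_sqrt q) by lra. pose proof (sqrt_pos q).
    pose proof (sqrt_pos (rad (u m) ^ 2 + rad (u n) ^ 2 - 2 * cone_ip d (u m) (u n))).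
    fold (cone_dist d (u m) (u n)) in *. nra. }
  rewrite cone_dist_sqr, cone_dist_sqr_polar in Hlt.
  pose proof (pow2_ge_0 (rad (u m) - rad (u n))).
  assert (r * r <= rad (u m) * rad (u n)).
  { apply Rmult_le_compat; try lra; apply Hrad; lia. }
  assert (q <= 2 * (rad (u m) * rad (u n)) * (1 - cos (d (dir (u m)) (dir (u n))))).
  { unfold q. apply Rmult_le_compat; lra || nra. }
  lra.
Qed.

Lemma cone_over_complete (A : Z -> Prop) (x0 : Z) : A x0 -> complete_set d A ->
  complete_set (cone_dist d) (cone_over A).
Proof.
  intros Hx0 HA u Hu Hc.
  destruct (rad_converges u Hc) as [r [Hr Hrlim]].
  assert (Hdir : exists x, A x /\ forall e, 0 < e ->
    exists N, forall n, (N <= n)%nat -> r * d (dir (u n)) x < e).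
  { destruct Hr as [Hr| <-].
    - destruct (HA (fun n => dir (u n)) Hu) as [x [Ax Hx]].
      + apply (dir_cauchy u (r / 2)); [lra| |exact Hc].
        destruct (Hrlim (r / 2) ltac:(lra)) as [N HN]. exists N. intros n Hn.
        specialize (HN n Hn). unfold Rdist in HN. apply Rabs_def2 in HN. lra.
      + exists x. split; [exact Ax|]. intros e He.
        destruct (Hx (e / r) ltac:(apply Rdiv_lt_0_compat; lra)) as [N HN].
        exists N. intros n Hn. rewrite Rmult_comm. apply Rlt_div_r; auto.
    - exists x0. split; [exact Hx0|]. intros e He. exists O. intros n _. lra. }
  destruct Hdir as [x [Ax Hx]].
  exists (ConePoint r x Hr). split; [exact Ax|]. intros e He.
  destruct (Hrlim (e / 2) ltac:(lra)) as [N HN]. destruct (Hx (e / 2) ltac:(lra)) as [N' HN'].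
  exists (max N N'). intros n Hn. specialize (HN n ltac:(lia)). specialize (HN' n ltac:(lia)).
  unfold Rdist in HN.
  apply Rle_lt_trans with (1 := cone_dist_le (u n) (ConePoint r x Hr)). simpl. lra.
Qed.

Lemma is_cone_sum_of_dir (v w u : cone Z) :
  rad u ^ 2 <= rad v ^ 2 + rad w ^ 2 + 2 * cone_ip d v w ->
  (forall z, rad v * cos (d z (dir v)) + rad w * cos (d z (dir w))
    <= rad u * cos (d z (dir u))) ->
  is_cone_sum d v w u.
Proof.
  intros Hrad Hdir. split; [exact Hrad|]. intros z. unfold cone_ip.
  pose proof (Rmult_le_compat_l _ _ _ (rad_ge0 z) (Hdir (dir z))). lra.
Qed.

Lemma is_cone_sum_sym (v w u : cone Z) : is_cone_sum d v w u -> is_cone_sum d w v u.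
Proof.
  intros [Hrad Hip]. split.
  - rewrite (cone_ip_sym w v). lra.
  - intros z. rewrite Rplus_comm. apply Hip.
Qed.

Section Combination.

Context (A : Z -> Prop).
Hypothesis A_sums : has_cone_sums d A.

Lemma cone_sum_spec (v w : cone Z) : is_cone_sum d v w (cone_sum d A v w) /\
  (cone_over A v -> cone_over A w -> cone_over A (cone_sum d A v w)).
Proof. exact (epsilon_spec (inhabits v) _ (A_sums v w)). Qed.

Lemma cone_over_convex : convex_set (cone_comb d A) (cone_over A).
Proof. intros t v w _ Hv Hw. apply cone_sum_spec; assumption. Qed.

Lemma cone_ip_comb (t : R) (v w z : cone Z) : 0 <= t <= 1 ->
  (1 - t) * cone_ip d z v + t * cone_ip d z w <= cone_ip d z (cone_comb d A t v w).
Proof.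
  intros Ht. rewrite <- !cone_ip_scale_r by lra. apply cone_sum_spec.
Qed.

Lemma cone_comb_npc : npc_combination (cone_dist d) (cone_comb d A).
Proof.
  intros t v w z Ht. rewrite !cone_dist_sqr.
  pose proof (cone_ip_comb t v w z Ht).
  destruct (proj1 (cone_sum_spec (cone_scale (1 - t) v) (cone_scale t w))) as [Hrad _].
  fold (cone_comb d A t v w) in Hrad.
  rewrite cone_ip_scale_l, cone_ip_scale_r, !rad_scale in Hrad by lra. nra.
Qed.

Lemma rad_comb_le (t r : R) (v w : cone Z) : 0 <= t <= 1 -> rad v <= r -> rad w <= r ->
  rad (cone_comb d A t v w) <= r.
Proof.
  intros Ht Hv Hw.
  rewrite <- (cone_dist_apex (cone_comb d A t v w) (dir v)),
    (pdist_sym cone_dist_pseudometric).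
  pose proof (rad_ge0 v). pose proof (rad_ge0 w). apply pow2_le_reg; [lra|].
  pose proof (cone_comb_npc t v w (cone_apex (dir v)) Ht) as Hnpc.
  rewrite !(pdist_sym cone_dist_pseudometric (cone_apex (dir v))), !cone_dist_apex in *.
  assert (0 <= t * (1 - t) * cone_dist d v w ^ 2).
  { apply Rmult_le_pos; [nra|apply pow2_ge_0]. }
  assert (rad v ^ 2 <= r ^ 2) by (apply pow_incr; lra).
  assert (rad w ^ 2 <= r ^ 2) by (apply pow_incr; lra).
  nra.
Qed.

Lemma cone_ip_lipschitz (v w z : cone Z) :
  cone_ip d v z <= cone_ip d w z + rad z * cone_dist d v w.
Proof.
  pose proof (quadrilateral cone_dist_pseudometric _ v w (cone_apex (dir z)) z cone_comb_npc) as H.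
  rewrite !(pdist_sym cone_dist_pseudometric (cone_apex (dir z))), !cone_dist_apex in H.
  rewrite (cone_dist_sqr w z), (cone_dist_sqr z v), (cone_ip_sym z v) in H. lra.
Qed.

End Combination.

Section ConicalProjection.

Context (K : cone Z -> Prop) (P : cone Z -> cone Z).
Hypothesis K_conical : conical K.
Hypothesis P_proj : is_projection (cone_dist d) K P.

Lemma conical_projection_ip (v : cone Z) : cone_ip d v (P v) = rad (P v) ^ 2.
Proof.
  destruct (P_proj v) as [HK Hang].
  pose proof (Hang _ (K_conical 2 _ ltac:(lra) HK)) as Hdouble.
  pose proof (Hang _ (K_conical 0 _ ltac:(lra) HK)) as Hzero.
  rewrite !cone_dist_sqr, !cone_ip_scale_r, !rad_scale, cone_ip_diag in Hdouble by lra.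
  rewrite !cone_dist_sqr, !cone_ip_scale_r, !rad_scale, cone_ip_diag in Hzero by lra. lra.
Qed.

Lemma conical_projection_pythagoras (v : cone Z) :
  rad (P v) ^ 2 + cone_dist d v (P v) ^ 2 = rad v ^ 2.
Proof. rewrite cone_dist_sqr, conical_projection_ip. ring. Qed.

Lemma conical_projection_dist_le_rad (v : cone Z) : cone_dist d v (P v) <= rad v.
Proof.
  apply pow2_le_reg; [apply rad_ge0|].
  pose proof (conical_projection_pythagoras v). pose proof (pow2_ge_0 (rad (P v))). lra.
Qed.

Lemma conical_projection_ip_le (v z : cone Z) : K z -> cone_ip d v z <= cone_ip d (P v) z.
Proof.
  intros Hz. pose proof (proj2 (P_proj v) z Hz) as H.
  rewrite !cone_dist_sqr, conical_projection_ip in H. lra.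
Qed.

End ConicalProjection.

(** * Retracting a space onto a subspace with a convex cone *)

Section ConeRetraction.

Context (A : Z -> Prop) (p : Z).
Hypothesis Z_complete : complete_set d (fun _ => True).
Hypothesis A_complete : complete_set d A.
Hypothesis A_sums : has_cone_sums d A.
Hypothesis A_p : A p.
Hypothesis p_near : forall x, d p x <= PI / 2.

Definition base_proj : cone Z -> cone Z := nearest (cone_dist d) (cone_over A).

Definition base_dist (v : cone Z) : R := cone_dist d v (base_proj v).

Lemma cone_over_conical : conical (cone_over A).
Proof. intros l v _ Hv. exact Hv. Qed.

Lemma base_proj_is_projection : is_projection (cone_dist d) (cone_over A) base_proj.
Proof.
  apply (nearest_is_projection cone_dist_pseudometric (cone_comb d A)).
  - apply cone_comb_npc, A_sums.
  - apply cone_over_convex, A_sums.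
  - exists (cone_unit p). exact A_p.
  - apply cone_over_complete with p; assumption.
Qed.

Lemma base_dist_ge0 (v : cone Z) : 0 <= base_dist v.
Proof. apply sqrt_pos. Qed.

Lemma base_dist_le (v z : cone Z) : cone_over A z -> base_dist v <= cone_dist d v z.
Proof.
  apply (projection_dist_le cone_dist_pseudometric (cone_over A)), base_proj_is_projection.
Qed.

Lemma base_dist_le_rad (v : cone Z) : base_dist v <= rad v.
Proof.
  apply (conical_projection_dist_le_rad (cone_over A));
    [apply cone_over_conical|apply base_proj_is_projection].
Qed.

Lemma base_dist_in (v : cone Z) : cone_over A v -> base_dist v = 0.
Proof.
  intros Hv. apply Rle_antisym; [|apply base_dist_ge0].
  rewrite <- (pdist_refl cone_dist_pseudometric v). apply base_dist_le, Hv.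
Qed.

Lemma base_dist_comb (t : R) (v w : cone Z) : 0 <= t <= 1 ->
  base_dist (cone_comb d A t v w) <= (1 - t) * base_dist v + t * base_dist w.
Proof.
  apply (projection_dist_convex cone_dist_pseudometric _ (cone_over A)).
  - apply cone_comb_npc, A_sums.
  - apply base_proj_is_projection.
  - apply cone_over_convex, A_sums.
Qed.

Definition height (v : cone Z) : R := cone_ip d v (cone_unit p).

Lemma height_ge0 (v : cone Z) : 0 <= height v.
Proof.
  unfold height, cone_ip. simpl. rewrite Rmult_1_r.
  apply Rmult_le_pos; [apply rad_ge0|].
  rewrite (pdist_sym d_pm). pose proof PI_RGT_0. pose proof (p_near (dir v)).
  apply cos_ge_0; [pose proof (pdist_ge0 d_pm p (dir v)); lra|lra].
Qed.

Lemma height_le_rad (v : cone Z) : height v <= rad v.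
Proof.
  unfold height, cone_ip. simpl. pose proof (rad_ge0 v).
  pose proof (COS_bound (d (dir v) p)). nra.
Qed.

Lemma height_comb (t : R) (v w : cone Z) : 0 <= t <= 1 ->
  (1 - t) * height v + t * height w <= height (cone_comb d A t v w).
Proof.
  intros Ht. unfold height.
  rewrite (cone_ip_sym v), (cone_ip_sym w), (cone_ip_sym (cone_comb d A t v w)).
  apply cone_ip_comb; assumption.
Qed.

Lemma height_base_proj (v : cone Z) : height v <= height (base_proj v).
Proof.
  apply (conical_projection_ip_le (cone_over A));
    [apply cone_over_conical|apply base_proj_is_projection|exact A_p].
Qed.

(* In the model case of a hemisphere inside a higher-dimensional one, [wedge t] is a
   half-space rotating about the boundary of the smaller hemisphere. *)
Definition wedge (t : R) (v : cone Z) : Prop := t * base_dist v <= (1 - t) * height v.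

Lemma wedge_0 (v : cone Z) : wedge 0 v.
Proof. unfold wedge. pose proof (height_ge0 v). lra. Qed.

Lemma wedge_1 (v : cone Z) : wedge 1 v -> base_dist v = 0.
Proof. unfold wedge. pose proof (base_dist_ge0 v). lra. Qed.

Lemma wedge_base (t : R) (v : cone Z) : t <= 1 -> cone_over A v -> wedge t v.
Proof.
  intros Ht Hv. unfold wedge. rewrite base_dist_in by exact Hv.
  pose proof (height_ge0 v). nra.
Qed.

Lemma wedge_decr (s t : R) (v : cone Z) : 0 <= s -> s <= t -> t <= 1 -> wedge t v -> wedge s v.
Proof.
  unfold wedge. pose proof (height_ge0 v). pose proof (base_dist_ge0 v). nra.
Qed.

Lemma wedge_conical (t : R) : 0 <= t -> conical (wedge t).
Proof.
  intros Ht l v Hl Hv. unfold wedge, height in *. rewrite cone_ip_scale_l by exact Hl.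
  assert (base_dist (cone_scale l v) <= l * base_dist v).
  { unfold base_dist at 2. rewrite <- cone_dist_scale by exact Hl.
    apply base_dist_le, cone_over_conical; [exact Hl|apply base_proj_is_projection]. }
  apply Rle_trans with (l * (t * base_dist v)); nra.
Qed.

Lemma wedge_convex (t : R) : 0 <= t <= 1 -> convex_set (cone_comb d A) (wedge t).
Proof.
  intros Ht l v w Hl Hv Hw. unfold wedge in *.
  pose proof (base_dist_comb l v w Hl) as Hbase. pose proof (height_comb l v w Hl) as Hheight.
  apply (Rmult_le_compat_l t) in Hbase; [|lra].
  apply (Rmult_le_compat_l (1 - t)) in Hheight; [|lra].
  apply (Rmult_le_compat_l (1 - l)) in Hv; [|lra].
  apply (Rmult_le_compat_l l) in Hw; [|lra].
  lra.
Qed.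

Lemma wedge_complete (t : R) : 0 <= t <= 1 -> complete_set (cone_dist d) (wedge t).
Proof.
  intros Ht.
  assert (H : complete_set (cone_dist d)
    (fun v => t * base_dist v - (1 - t) * height v <= 0)).
  { apply (complete_sublevel cone_dist_pseudometric).
    - intros v w.
      pose proof (projection_dist_lipschitz cone_dist_pseudometric (cone_over A) _
        base_proj_is_projection v w) as Hbase.
      pose proof (cone_ip_lipschitz A A_sums w v (cone_unit p)) as Hheight.
      rewrite (pdist_sym cone_dist_pseudometric w v) in Hheight. simpl rad in Hheight.
      unfold base_dist, height. nra.
    - exact (cone_over_complete (fun _ => True) p I Z_complete). }
  intros u Hu Hc. destruct (H u) as [l [Hl Hlim]].
  - intros n. specialize (Hu n). unfold wedge in Hu. lra.
  - exact Hc.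
  - exists l. unfold wedge. split; [lra|exact Hlim].
Qed.

Lemma wedge_near (t e : R) (v : cone Z) : 0 <= t <= 1 -> 0 <= e ->
  t * base_dist v <= (1 - t) * height v + t * e ->
  exists z, wedge t z /\ cone_dist d v z <= e.
Proof.
  intros Ht He Hv. pose proof base_proj_is_projection as HP.
  destruct (Rle_or_lt (base_dist v) e) as [Hle|Hlt].
  - exists (base_proj v). split; [|exact Hle]. apply wedge_base; [lra|apply HP].
  - set (l := e / base_dist v).
    assert (El : l * base_dist v = e) by (unfold l; field; lra).
    assert (Hl : 0 <= l <= 1).
    { split; [apply Rdiv_le_0_compat; lra|].
      apply Rmult_le_reg_r with (base_dist v); lra. }
    pose proof (cone_comb_npc A A_sums) as Hnpc.
    exists (cone_comb d A l v (base_proj v)). split.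
    + unfold wedge.
      pose proof (base_dist_comb l v (base_proj v) Hl) as Hbase.
      rewrite (base_dist_in (base_proj v)) in Hbase by apply HP.
      pose proof (height_comb l v (base_proj v) Hl). pose proof (height_base_proj v).
      assert (height v <= height (cone_comb d A l v (base_proj v))) by nra. nra.
    + apply Rle_trans with (1 := comb_dist_l cone_dist_pseudometric _ l v _ Hnpc Hl).
      right. exact El.
Qed.

Definition tilt (l : R) (v : cone Z) : cone Z :=
  cone_comb d A l v (ConePoint (rad v) p (rad_ge0 v)).

Lemma rad_tilt (l : R) (v : cone Z) : 0 <= l <= 1 -> rad (tilt l v) <= rad v.
Proof. intros Hl. apply rad_comb_le; simpl; auto with real. Qed.

Lemma base_dist_tilt (l : R) (v : cone Z) : 0 <= l <= 1 ->
  base_dist (tilt l v) <= (1 - l) * base_dist v.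
Proof.
  intros Hl. pose proof (base_dist_comb l v (ConePoint (rad v) p (rad_ge0 v)) Hl) as H.
  rewrite (base_dist_in (ConePoint (rad v) p (rad_ge0 v))) in H by exact A_p.
  unfold tilt. lra.
Qed.

Lemma height_tilt (l : R) (v : cone Z) : 0 <= l <= 1 ->
  (1 - l) * height v + l * rad v <= height (tilt l v).
Proof.
  intros Hl. pose proof (height_comb l v (ConePoint (rad v) p (rad_ge0 v)) Hl) as H.
  replace (height (ConePoint (rad v) p (rad_ge0 v))) with (rad v) in H; [exact H|].
  unfold height, cone_ip. simpl. rewrite (pdist_refl d_pm), cos_0. ring.
Qed.

Lemma tilt_dist (l : R) (v : cone Z) : 0 <= l <= 1 -> cone_dist d v (tilt l v) <= 2 * l * rad v.
Proof.
  intros Hl. set (q := ConePoint (rad v) p (rad_ge0 v)).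
  pose proof (comb_dist_l cone_dist_pseudometric _ l v q (cone_comb_npc A A_sums) Hl) as Hvq.
  pose proof (pdist_triangle cone_dist_pseudometric v (cone_apex p) q) as Hapex.
  rewrite (pdist_sym cone_dist_pseudometric (cone_apex p)), !cone_dist_apex in Hapex.
  simpl rad in Hapex. unfold tilt. fold q. nra.
Qed.

(* Tilting towards [p] gains enough height for the remaining move towards the base. *)
Lemma wedge_speed_short (s t : R) (v : cone Z) : 0 <= s -> s <= t -> t <= 1 -> t - s <= 1 / 2 ->
  wedge s v -> exists z, wedge t z /\ cone_dist d v z <= 6 * (t - s) * rad v.
Proof.
  intros Hs Hst Ht Hshort Hv. set (h := t - s).
  assert (Eh : t = s + h) by (unfold h; ring).
  assert (Hh : 0 <= 2 * h <= 1) by lra.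
  pose proof (rad_ge0 v). pose proof (rad_tilt (2 * h) v Hh).
  pose proof (base_dist_tilt (2 * h) v Hh) as Hbase.
  pose proof (height_tilt (2 * h) v Hh) as Hheight.
  pose proof (tilt_dist (2 * h) v Hh). set (v' := tilt (2 * h) v) in *.
  pose proof (base_dist_le_rad v'). pose proof (height_le_rad v').
  destruct (wedge_near t (2 * h * rad v) v') as [z [Hz Hv'z]]; [lra|nra| |].
  - unfold wedge in Hv.
    assert (Hsv : s * base_dist v' <= (1 - s) * (height v' - 2 * h * rad v)).
    { apply Rle_trans with ((1 - 2 * h) * (s * base_dist v)); [nra|].
      apply Rle_trans with ((1 - 2 * h) * ((1 - s) * height v)); nra. }
    assert (Hgain : h * (base_dist v' + height v') <= h * (2 * rad v))
      by (apply Rmult_le_compat_l; lra).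
    assert (0 <= h * h * rad v) by (apply Rmult_le_pos; nra).
    rewrite Eh. nra.
  - exists z. split; [exact Hz|].
    pose proof (pdist_triangle cone_dist_pseudometric v v' z). lra.
Qed.

Lemma wedge_speed (s t : R) (v : cone Z) : 0 <= s -> s <= t -> t <= 1 ->
  wedge s v -> exists z, wedge t z /\ cone_dist d v z <= 6 * (t - s) * rad v.
Proof.
  intros Hs Hst Ht Hv.
  destruct (Rle_or_lt (t - s) (1 / 2)) as [Hshort|Hlong]; [apply wedge_speed_short; auto|].
  exists (cone_apex p). split; [apply wedge_base; [exact Ht|exact A_p]|].
  rewrite cone_dist_apex. pose proof (rad_ge0 v). nra.
Qed.

Definition wedge_proj (t : R) : cone Z -> cone Z := nearest (cone_dist d) (wedge t).

Lemma wedge_proj_is_projection (t : R) : 0 <= t <= 1 ->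
  is_projection (cone_dist d) (wedge t) (wedge_proj t).
Proof.
  intros Ht. apply (nearest_is_projection cone_dist_pseudometric (cone_comb d A)).
  - apply cone_comb_npc, A_sums.
  - apply wedge_convex, Ht.
  - exists (cone_unit p). apply wedge_base; [lra|exact A_p].
  - apply wedge_complete, Ht.
Qed.

Lemma wedge_proj_pythagoras (t : R) (v : cone Z) : 0 <= t <= 1 ->
  cone_dist d (wedge_proj t v) (cone_apex p) ^ 2 + cone_dist d v (wedge_proj t v) ^ 2
    = cone_dist d v (cone_apex p) ^ 2.
Proof.
  intros Ht. rewrite !cone_dist_apex. apply (conical_projection_pythagoras (wedge t)).
  - apply wedge_conical. lra.
  - apply wedge_proj_is_projection, Ht.
Qed.

Lemma wedge_proj_speed (s t : R) (v : cone Z) : 0 <= s -> s <= t -> t <= 1 -> wedge s v ->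
  cone_dist d v (wedge_proj t v) <= 6 * (t - s) * cone_dist d v (cone_apex p).
Proof.
  intros Hs Hst Ht Hv. rewrite cone_dist_apex.
  destruct (wedge_speed s t v Hs Hst Ht Hv) as [z [Hz Hvz]].
  apply Rle_trans with (2 := Hvz).
  apply (projection_dist_le cone_dist_pseudometric (wedge t)); [|exact Hz].
  apply wedge_proj_is_projection. lra.
Qed.

Lemma cone_retraction_exists : exists F : cone Z -> cone Z,
  (forall v, cone_over A (F v) /\ rad (F v) = rad v) /\
  (forall v w, cone_dist d (F v) (F w) <= cone_dist d v w) /\
  (forall v, cone_over A v -> cone_dist d (F v) v = 0).
Proof.
  pose proof cone_dist_pseudometric as D_pm.
  destruct (sweep_retraction_exists D_pm (cone_comb d A) wedge wedge_proj (cone_apex p) 1 6)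
    as [G [Gin [Gshort Gfix]]]; try lra.
  { apply cone_comb_npc, A_sums. }
  { exact wedge_decr. }
  { exact wedge_proj_is_projection. }
  { intros t v. apply wedge_proj_pythagoras. }
  { exact wedge_proj_speed. }
  { apply wedge_complete. lra. }
  assert (G_base : forall v, cone_dist d (G v) (base_proj (G v)) = 0).
  { intros v. apply wedge_1, Gin, wedge_0. }
  exists (fun v => base_proj (G v)). split; [|split].
  - intros v. split; [apply base_proj_is_projection|].
    destruct (Gin v (wedge_0 v)) as [_ Hrad]. rewrite !cone_dist_apex in Hrad.
    pose proof (rad_dist_le (G v) (base_proj (G v))) as H. rewrite G_base in H.
    apply Rabs_le_between in H. lra.
  - intros v w. apply Rle_trans with (2 := Gshort v w (wedge_0 v) (wedge_0 w)).
    apply (projection_short D_pm (cone_comb d A) (cone_over A)).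
    + apply cone_comb_npc, A_sums.
    + apply base_proj_is_projection.
  - intros v Hv. apply Rle_antisym; [|apply (pdist_ge0 D_pm)].
    pose proof (Gfix v (wedge_base 1 v ltac:(lra) Hv)).
    pose proof (pdist_triangle D_pm (base_proj (G v)) (G v) v) as Htri.
    rewrite (pdist_sym D_pm (base_proj (G v)) (G v)), G_base in Htri. lra.
Qed.

Theorem cone_sums_retraction : exists f : Z -> Z,
  (forall x, A (f x)) /\
  (forall x y, d (f x) (f y) <= d x y) /\
  (forall x, A x -> d (f x) x = 0).
Proof.
  destruct cone_retraction_exists as [F [Fin [Fshort Ffix]]].
  assert (Frad : forall x, rad (F (cone_unit x)) = 1) by (intros x; apply Fin).
  exists (fun x => dir (F (cone_unit x))). split; [|split].
  - intros x. apply Fin.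
  - intros x y. apply dir_dist_le_of_unit; auto.
  - intros x Hx. apply Rle_antisym; [|apply (pdist_ge0 d_pm)].
    rewrite <- (pdist_refl d_pm x).
    apply (dir_dist_le_of_unit (F (cone_unit x)) (cone_unit x)); auto.
    rewrite (Ffix (cone_unit x) Hx). apply sqrt_pos.
Qed.

End ConeRetraction.

End ConeMetric.

(** * Vector sums in the cone over a CAT(1) space *)

Definition equator (s : R) : R3 := (cos s, sin s, 0).

Lemma equator_on_S2 (s : R) : on_S2 (equator s).
Proof. unfold on_S2. simpl. pose proof (sin2_cos2 s). unfold Rsqr in *. lra. Qed.

Lemma dot3_sym (u v : R3) : dot3 u v = dot3 v u.
Proof. destruct u as [[u1 u2] u3], v as [[v1 v2] v3]. simpl. ring. Qed.

Lemma dot3_bound (u v : R3) : on_S2 u -> on_S2 v -> -1 <= dot3 u v <= 1.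
Proof.
  destruct u as [[u1 u2] u3], v as [[v1 v2] v3]. unfold on_S2, dot3. intros Hu Hv.
  pose proof (pow2_ge_0 (u1 - v1)). pose proof (pow2_ge_0 (u2 - v2)).
  pose proof (pow2_ge_0 (u3 - v3)). pose proof (pow2_ge_0 (u1 + v1)).
  pose proof (pow2_ge_0 (u2 + v2)). pose proof (pow2_ge_0 (u3 + v3)). lra.
Qed.

Lemma sdist_eq (u v : R3) (a : R) : 0 <= a <= PI -> dot3 u v = cos a -> sdist u v = a.
Proof. intros Ha E. unfold sdist. rewrite E. apply acos_cos, Ha. Qed.

Lemma dot3_equator (s t : R) : dot3 (equator s) (equator t) = cos (t - s).
Proof. simpl. rewrite cos_minus. ring. Qed.

Lemma dot3_equator_interpolate (z : R3) (l s : R) :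
  dot3 z (equator 0) * sin (l - s) + dot3 z (equator l) * sin s
    = sin l * dot3 z (equator s).
Proof.
  destruct z as [[z1 z2] z3]. simpl. rewrite cos_0, sin_0, sin_minus. ring.
Qed.

Lemma cos_third_side_bounds (a b l : R) : 0 <= a <= PI -> 0 <= b <= PI -> 0 <= l <= PI ->
  a <= b + l -> b <= a + l -> l <= a + b -> a + b + l <= 2 * PI ->
  cos (a + l) <= cos b <= cos (a - l).
Proof.
  intros Ha Hb Hl Hal Hbl Hlb Hper. split.
  - destruct (Rle_or_lt (a + l) PI).
    + apply cos_decr_1; lra.
    + replace (cos (a + l)) with (cos (2 * PI - (a + l)))
        by (rewrite cos_minus, cos_2PI, sin_2PI; ring).
      apply cos_decr_1; lra.
  - destruct (Rle_or_lt l a).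
    + apply cos_decr_1; lra.
    + rewrite <- (cos_neg (a - l)), Ropp_minus_distr. apply cos_decr_1; lra.
Qed.

Lemma interpolated_cos_le (a b l s : R) : 0 <= s -> 0 <= a <= PI -> 0 <= b <= PI ->
  0 < l < PI -> s <= l -> 2 * PI <= a + b + l ->
  cos a * sin (l - s) + cos b * sin s <= sin l * cos (a + s).
Proof.
  intros Hs Ha Hb Hl Hsl Hper.
  assert (Hcos : cos b <= cos (a + l)).
  { replace (cos (a + l)) with (cos (2 * PI - (a + l)))
      by (rewrite cos_minus, cos_2PI, sin_2PI; ring).
    apply cos_decr_1; lra. }
  assert (0 <= sin s) by (apply sin_ge_0; lra).
  assert (E : sin l * cos (a + s) - cos a * sin (l - s) = cos (a + l) * sin s)
    by (rewrite !cos_plus, sin_minus; ring).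
  nra.
Qed.

Lemma spherical_triangle_exists (a b l : R) : 0 <= a <= PI -> 0 <= b <= PI -> 0 < l < PI ->
  a <= b + l -> b <= a + l -> l <= a + b -> a + b + l <= 2 * PI ->
  exists z, on_S2 z /\ dot3 z (equator 0) = cos a /\ dot3 z (equator l) = cos b.
Proof.
  intros Ha Hb Hl Hal Hbl Hlb Hper.
  destruct (cos_third_side_bounds a b l Ha Hb ltac:(lra) Hal Hbl Hlb Hper) as [Hlo Hhi].
  rewrite cos_plus in Hlo. rewrite cos_minus in Hhi.
  assert (Hsl : 0 < sin l) by (apply sin_gt_0; lra).
  assert (Hsa : 0 <= sin a) by (apply sin_ge_0; lra).
  set (y := (cos b - cos a * cos l) / sin l).
  assert (Ey : y * sin l = cos b - cos a * cos l) by (unfold y; field; lra).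
  assert (Hy : - sin a <= y <= sin a)
    by (split; apply Rmult_le_reg_r with (sin l); lra).
  assert (Hdisc : 0 <= 1 - cos a ^ 2 - y ^ 2).
  { pose proof (sin2_cos2 a). unfold Rsqr in *. nra. }
  exists (cos a, y, sqrt (1 - cos a ^ 2 - y ^ 2)). split; [|split].
  - unfold on_S2. simpl. rewrite sqrt_sqrt by exact Hdisc. ring.
  - simpl. rewrite cos_0, sin_0. ring.
  - simpl. lra.
Qed.

Lemma polar_coordinates (x y : R) : 0 <= y ->
  exists r t, 0 <= r /\ 0 <= t <= PI /\ r * cos t = x /\ r * sin t = y.
Proof.
  intros Hy. pose proof PI_RGT_0.
  assert (Hq : 0 <= x ^ 2 + y ^ 2) by (pose proof (pow2_ge_0 x); pose proof (pow2_ge_0 y); lra).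
  set (r := sqrt (x ^ 2 + y ^ 2)).
  assert (Er : r ^ 2 = x ^ 2 + y ^ 2) by (apply pow2_sqrt, Hq).
  destruct (sqrt_pos (x ^ 2 + y ^ 2)) as [Hr|Hr]; fold r in Hr.
  - assert (Hx : -1 <= x / r <= 1).
    { assert (- r <= x <= r) by (pose proof (pow2_ge_0 y); split; nra).
      split; [apply Rle_div_r|apply Rle_div_l]; lra. }
    exists r, (acos (x / r)). pose proof (acos_bound (x / r)) as Hacos.
    assert (Ex : r * cos (acos (x / r)) = x) by (rewrite cos_acos by exact Hx; field; lra).
    repeat split; try lra.
    assert (0 <= sin (acos (x / r))) by (apply sin_ge_0; lra).
    pose proof (sin2_cos2 (acos (x / r))) as Hsc. unfold Rsqr in Hsc.
    assert ((r * sin (acos (x / r))) ^ 2 = y ^ 2).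
    { replace ((r * sin (acos (x / r))) ^ 2) with (r ^ 2 - (r * cos (acos (x / r))) ^ 2);
        [rewrite Ex; lra|].
      replace (r ^ 2) with (r ^ 2 * (sin (acos (x / r)) * sin (acos (x / r))
        + cos (acos (x / r)) * cos (acos (x / r)))) by (rewrite Hsc; ring).
      ring. }
    assert (0 <= r * sin (acos (x / r))) by nra. nra.
  - rewrite <- Hr in Er. pose proof (pow2_ge_0 x). pose proof (pow2_ge_0 y).
    exists 0, 0. repeat split; nra.
Qed.

Lemma planar_sum_exists (r s l : R) : 0 <= r -> 0 <= s -> 0 < l < PI ->
  exists a t, 0 <= a /\ 0 <= t <= l /\ a * cos t = r + s * cos l /\ a * sin t = s * sin l.
Proof.
  intros Hr Hs Hl.
  assert (Hsl : 0 < sin l) by (apply sin_gt_0; lra).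
  destruct (polar_coordinates (r + s * cos l) (s * sin l) ltac:(nra)) as [a [t [Ha [Ht [Ec Es]]]]].
  destruct (Rle_or_lt t l) as [Htl|Hlt]; [exists a, t; tauto|].
  assert (Hst : 0 < sin (t - l)) by (apply sin_gt_0; lra).
  assert (E : a * sin (t - l) = - (r * sin l)).
  { rewrite sin_minus.
    replace (a * (sin t * cos l - cos t * sin l))
      with (a * sin t * cos l - a * cos t * sin l) by ring.
    rewrite Es, Ec. ring. }
  assert (Ha0 : a = 0) by nra. subst a.
  exists 0, 0. repeat split; lra.
Qed.

Definition sine_comparison_at {X : Type} (d : X -> X -> R) (x y z : X) (g : R -> X) (s : R)
    : Prop :=
  cos (d z x) * sin (d x y - s) + cos (d z y) * sin s <= sin (d x y) * cos (d z (g s)).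

Section CAT1.

Context {X : Type} {d : X -> X -> R} (d_pm : is_pseudometric d).
Hypothesis d_cat : CAT1 d.

Lemma geodesic_dist_l (x y : X) (g : R -> X) (s : R) : geodesic d x y g ->
  0 <= s <= d x y -> d x (g s) = s.
Proof.
  intros [Hx [_ Hg]] Hs. rewrite <- Hx at 1. rewrite Hg by lra.
  rewrite Rabs_minus_sym, Rminus_0_r. apply Rabs_pos_eq. lra.
Qed.

Lemma geodesic_dist_r (x y : X) (g : R -> X) (s : R) : geodesic d x y g ->
  0 <= s <= d x y -> d y (g s) = d x y - s.
Proof.
  intros [_ [Hy Hg]] Hs. rewrite <- Hy at 1. rewrite Hg by lra.
  apply Rabs_pos_eq. lra.
Qed.

Lemma side_point_equator (x y : X) (g : R -> X) (s : R) : geodesic d x y g ->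
  d x y <= PI -> 0 <= s <= d x y ->
  side_point d x y g (equator 0) (equator (d x y)) (g s) (equator s).
Proof.
  intros Hg Hl Hs. exists s. split; [exact Hs|]. split; [reflexivity|].
  split; [apply equator_on_S2|]. split.
  - apply sdist_eq; [lra|]. rewrite dot3_equator. f_equal. ring.
  - apply sdist_eq; [lra|]. apply dot3_equator.
Qed.

Lemma side_point_end (x y : X) (g : R -> X) (ux uy : R3) : geodesic d x y g ->
  on_S2 uy -> sdist ux uy = d x y -> side_point d x y g ux uy y uy.
Proof.
  intros [_ [Hy _]] Ouy Huy. exists (d x y). pose proof (pdist_ge0 d_pm x y).
  repeat split; auto; try lra.
  rewrite Rminus_diag. unfold sdist. rewrite Ouy. apply acos_1.
Qed.

(* By [dot3_equator_interpolate] the left-hand side of the estimate is [sin (d x y)] times the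
   cosine of the distance between the corresponding points of the comparison triangle. *)
Lemma sine_comparison_small (x y z : X) (g : R -> X) (s : R) : geodesic d x y g ->
  0 < d x y < PI -> 0 <= s <= d x y -> d x y + d y z + d z x < 2 * PI ->
  sine_comparison_at d x y z g s.
Proof.
  intros Hg Hl Hs Hper.
  pose proof (pdist_triangle d_pm z y x) as Hzyx. pose proof (pdist_triangle d_pm z x y) as Hzxy.
  pose proof (pdist_triangle d_pm x z y) as Hxzy.
  rewrite (pdist_sym d_pm y z) in *. rewrite (pdist_sym d_pm y x) in Hzyx.
  rewrite (pdist_sym d_pm x z) in Hxzy.
  pose proof (pdist_ge0 d_pm z x) as Hzx. pose proof (pdist_ge0 d_pm z y) as Hzy.
  destruct (spherical_triangle_exists (d z x) (d z y) (d x y)) as [z3 [Oz [Ex Ey]]]; try lra.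
  unfold sine_comparison_at. rewrite <- Ex, <- Ey, dot3_equator_interpolate.
  apply Rmult_le_compat_l; [apply sin_ge_0; lra|].
  destruct (proj1 d_cat y z) as [gyz Hyz]; [rewrite (pdist_sym d_pm y z); lra|].
  destruct (proj1 d_cat z x) as [gzx Hgzx]; [lra|].
  assert (Syz : sdist (equator (d x y)) z3 = d y z).
  { rewrite (pdist_sym d_pm y z). apply sdist_eq; [lra|]. rewrite dot3_sym. exact Ey. }
  assert (Hcmp : d z (g s) <= sdist z3 (equator s)).
  { apply (proj2 d_cat x y z g gyz gzx Hg Hyz Hgzx) with (u1 := equator 0)
      (u2 := equator (d x y)) (u3 := z3); auto using equator_on_S2.
    - rewrite (pdist_sym d_pm y z). exact Hper.
    - apply sdist_eq; [lra|]. rewrite dot3_equator. f_equal. ring.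
    - apply sdist_eq; [lra|exact Ex].
    - right. left. apply side_point_end; assumption.
    - left. apply side_point_equator; [exact Hg|lra|exact Hs]. }
  rewrite <- (cos_acos (dot3 z3 (equator s))) by (apply dot3_bound; auto using equator_on_S2).
  pose proof (acos_bound (dot3 z3 (equator s))).
  pose proof (pdist_ge0 d_pm z (g s)). unfold sdist in Hcmp. apply cos_decr_1; lra.
Qed.

Hypothesis d_le_PI : forall x y, d x y <= PI.

(* Comparison triangles of perimeter at least [2 PI] need not exist, but there the
   estimate follows from the triangle inequality alone. *)
Lemma sine_comparison_large (x y z : X) (g : R -> X) (s : R) : geodesic d x y g ->
  0 < d x y < PI -> 0 <= s <= d x y -> 2 * PI <= d x y + d y z + d z x ->
  sine_comparison_at d x y z g s.
Proof.
  intros Hg Hl Hs Hper. unfold sine_comparison_at. rewrite (pdist_sym d_pm y z) in Hper.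
  pose proof (geodesic_dist_l x y g s Hg Hs) as Dx.
  pose proof (geodesic_dist_r x y g s Hg Hs) as Dy.
  pose proof (pdist_triangle d_pm z x (g s)) as Tx. rewrite Dx in Tx.
  pose proof (pdist_triangle d_pm z y (g s)) as Ty. rewrite Dy in Ty.
  set (l := d x y) in *.
  assert (Ha : 0 <= d z x <= PI) by (split; [apply (pdist_ge0 d_pm)|apply d_le_PI]).
  assert (Hb : 0 <= d z y <= PI) by (split; [apply (pdist_ge0 d_pm)|apply d_le_PI]).
  assert (Hc : 0 <= d z (g s)) by apply (pdist_ge0 d_pm).
  assert (Hsin : 0 <= sin l) by (apply sin_ge_0; lra).
  destruct (Rle_or_lt (d z x + s) PI) as [Hx|Hx].
  { apply Rle_trans with (sin l * cos (d z x + s)); [apply interpolated_cos_le; lra|].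
    apply Rmult_le_compat_l; [exact Hsin|apply cos_decr_1; lra]. }
  destruct (Rle_or_lt (d z y + (l - s)) PI) as [Hy|Hy].
  { apply Rle_trans with (sin l * cos (d z y + (l - s))).
    - pose proof (interpolated_cos_le (d z y) (d z x) l (l - s)) as H.
      replace (l - (l - s)) with s in H by ring. lra.
    - apply Rmult_le_compat_l; [exact Hsin|apply cos_decr_1; lra]. }
  assert (Cx : cos (d z x) <= - cos s).
  { rewrite <- Rtrigo_facts.cos_pi_minus. apply cos_decr_1; lra. }
  assert (Cy : cos (d z y) <= - cos (l - s)).
  { rewrite <- Rtrigo_facts.cos_pi_minus. apply cos_decr_1; lra. }
  assert (0 <= sin (l - s)) by (apply sin_ge_0; lra).
  assert (0 <= sin s) by (apply sin_ge_0; lra).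
  assert (El : sin l = sin (l - s) * cos s + cos (l - s) * sin s)
    by (rewrite <- sin_plus; f_equal; ring).
  pose proof (COS_bound (d z (g s))).
  apply Rle_trans with (- sin l); [rewrite El|]; nra.
Qed.

Lemma sine_comparison (x y z : X) (g : R -> X) (s : R) : geodesic d x y g ->
  0 < d x y < PI -> 0 <= s <= d x y ->
  sine_comparison_at d x y z g s.
Proof.
  intros Hg Hl Hs. destruct (Rlt_or_le (d x y + d y z + d z x) (2 * PI)).
  - apply sine_comparison_small; assumption.
  - apply sine_comparison_large; assumption.
Qed.

Lemma cone_sum_exists_same_dir (v w : cone X) : d (dir v) (dir w) = 0 ->
  exists u, is_cone_sum d v w u.
Proof.
  intros Hvw.
  exists (ConePoint (rad v + rad w) (dir w) (Rplus_le_le_0_compat _ _ (rad_ge0 v) (rad_ge0 w))).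
  apply is_cone_sum_of_dir; simpl rad; simpl dir.
  - unfold cone_ip. rewrite Hvw, cos_0. right. ring.
  - intros z. pose proof (pdist_triangle d_pm z (dir v) (dir w)).
    pose proof (pdist_triangle d_pm z (dir w) (dir v)) as Hwv.
    rewrite (pdist_sym d_pm (dir w) (dir v)) in Hwv.
    replace (d z (dir v)) with (d z (dir w)) by lra. lra.
Qed.

Lemma cone_sum_exists_antipodal (v w : cone X) : d (dir v) (dir w) = PI ->
  rad w <= rad v -> exists u, is_cone_sum d v w u.
Proof.
  intros Hvw Hle. assert (Hdiff : 0 <= rad v - rad w) by lra.
  exists (ConePoint (rad v - rad w) (dir v) Hdiff).
  apply is_cone_sum_of_dir; simpl rad; simpl dir.
  - unfold cone_ip. rewrite Hvw, cos_PI. right. ring.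
  - intros z. pose proof (pdist_triangle d_pm (dir v) z (dir w)) as H.
    rewrite Hvw, (pdist_sym d_pm (dir v)) in H.
    assert (cos (d z (dir w)) <= - cos (d z (dir v))).
    { rewrite <- Rtrigo_facts.cos_pi_minus.
      pose proof (pdist_ge0 d_pm z (dir v)). pose proof (d_le_PI z (dir v)).
      pose proof (d_le_PI z (dir w)). apply cos_decr_1; lra. }
    pose proof (rad_ge0 w). nra.
Qed.

Lemma cone_sum_exists_generic (v w : cone X) : 0 < d (dir v) (dir w) < PI ->
  exists u, is_cone_sum d v w u.
Proof.
  intros Hl. set (l := d (dir v) (dir w)) in *.
  assert (Hsl : 0 < sin l) by (apply sin_gt_0; lra).
  destruct (planar_sum_exists (rad v) (rad w) l (rad_ge0 v) (rad_ge0 w) Hl)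
    as [a [t [Ha [Ht [Ec Es]]]]].
  destruct (proj1 d_cat (dir v) (dir w)) as [g Hg]; [apply Hl|].
  exists (ConePoint a (g t) Ha). apply is_cone_sum_of_dir; simpl rad; simpl dir.
  - unfold cone_ip. fold l.
    pose proof (sin2_cos2 t) as Hsct. pose proof (sin2_cos2 l) as Hscl. unfold Rsqr in *.
    replace (a ^ 2) with ((a * cos t) ^ 2 + (a * sin t) ^ 2).
    2: { replace (a ^ 2) with (a ^ 2 * (sin t * sin t + cos t * cos t))
           by (rewrite Hsct; ring). ring. }
    rewrite Ec, Es.
    replace (rad w ^ 2) with (rad w ^ 2 * (sin l * sin l + cos l * cos l))
      by (rewrite Hscl; ring).
    right. ring.
  - intros z. pose proof (sine_comparison (dir v) (dir w) z g t Hg Hl Ht) as H.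
    unfold sine_comparison_at in H. fold l in H.
    apply Rmult_le_reg_l with (sin l); [exact Hsl|].
    apply (Rmult_le_compat_l a) in H; [|exact Ha].
    replace (a * (cos (d z (dir v)) * sin (l - t) + cos (d z (dir w)) * sin t))
      with (cos (d z (dir v)) * (sin l * (a * cos t) - cos l * (a * sin t))
        + cos (d z (dir w)) * (a * sin t)) in H by (rewrite sin_minus; ring).
    rewrite Ec, Es in H. lra.
Qed.

Lemma CAT1_has_cone_sums : has_cone_sums d (fun _ => True).
Proof.
  intros v w. enough (exists u, is_cone_sum d v w u) as [u Hu].
  { exists u. split; [exact Hu|easy]. }
  destruct (pdist_ge0 d_pm (dir v) (dir w)) as [Hpos|Hzero];
    [|apply cone_sum_exists_same_dir; auto].
  destruct (d_le_PI (dir v) (dir w)) as [Hlt|Heq]; [apply cone_sum_exists_generic; auto|].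
  destruct (Rle_or_lt (rad w) (rad v)) as [Hle|Hlt].
  - apply cone_sum_exists_antipodal; assumption.
  - destruct (cone_sum_exists_antipodal w v) as [u Hu]; [|lra|].
    + rewrite (pdist_sym d_pm). exact Heq.
    + exists u. apply (is_cone_sum_sym d_pm), Hu.
Qed.

End CAT1.

(** * Ultracompletions *)

Lemma nonprincipal_ultrafilter_exists : exists w, ultrafilter w /\ nonprincipal w.
Proof.
  destruct (@filter.ultraFilterLemma _ filter.eventually filter.eventually_filter)
    as [G [G_ultra G_eventually]].
  pose proof (@filter.ultra_proper _ _ G_ultra) as G_proper.
  pose proof (@filter.filter_filter _ _ G_proper) as G_filter.
  assert (Hinter : forall A B : nat -> Prop, G A -> G B -> G (fun n => A n /\ B n)).
  { intros A B HA HB. exact (@filter.filterI _ _ G_filter A B HA HB). }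
  assert (Hmono : forall A B : nat -> Prop, (forall n, A n -> B n) -> G A -> G B).
  { intros A B HAB HA. exact (@filter.filterS _ _ G_filter A B HAB HA). }
  exists G. split.
  - repeat split; auto.
    + exact (@filter.filterT _ _ G_filter).
    + exact (@filter.filter_not_empty _ _ G_proper).
    + intros A. exact (@filter.in_ultra_setVsetC _ G A G_ultra).
  - intros k Hk. apply (@filter.filter_not_empty _ _ G_proper).
    assert (Hne : G (fun n => n <> k)).
    { apply G_eventually. exists (S k); [exact I|]. intros n Hn.
      apply (ssrbool.elimT ssrnat.leP) in Hn. lia. }
    apply Hmono with (2 := Hinter _ _ Hk Hne). intros n [Heq Hneq]. exact (Hneq Heq).
Qed.

Lemma filterlim_Rplus {T : Type} {F : (T -> Prop) -> Prop} {FF : Filter F}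
    (f g : T -> R) (a b : R) :
  filterlim f F (locally a) -> filterlim g F (locally b) ->
  filterlim (fun x => f x + g x) F (locally (a + b)).
Proof. intros Hf Hg. exact (filterlim_comp_2 f g Rplus Hf Hg (filterlim_plus a b)). Qed.

Lemma filterlim_Rmult {T : Type} {F : (T -> Prop) -> Prop} {FF : Filter F}
    (f g : T -> R) (a b : R) :
  filterlim f F (locally a) -> filterlim g F (locally b) ->
  filterlim (fun x => f x * g x) F (locally (a * b)).
Proof.
  intros Hf Hg. exact (filterlim_comp_2 f g Rmult Hf Hg (filterlim_mult (K := R_AbsRing) a b)).
Qed.

Lemma filter_forall_le {T : Type} {F : (T -> Prop) -> Prop} {FF : Filter F}
    (A : nat -> T -> Prop) (m : nat) :
  (forall i, (i <= m)%nat -> F (A i)) -> F (fun x => forall i, (i <= m)%nat -> A i x).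
Proof.
  induction m as [|m IH]; intros HA.
  - apply filter_imp with (2 := HA O (Nat.le_refl _)). intros x Hx i Hi.
    replace i with O by lia. exact Hx.
  - apply filter_imp with (2 := filter_and _ _ (IH (fun i Hi => HA i (le_S _ _ Hi)))
      (HA (S m) (Nat.le_refl _))).
    intros x [Hle Hlast] i Hi. destruct (Nat.eq_dec i (S m)) as [->|]; [exact Hlast|].
    apply Hle. lia.
Qed.

Lemma max_index_exists (P : nat -> Prop) (n : nat) :
  exists k, (P O -> P k) /\ forall j, (j <= n)%nat -> P j -> (j <= k)%nat.
Proof.
  induction n as [|n [k [Pk Hmax]]].
  - exists O. split; [auto|lia].
  - destruct (classic (P (S n))) as [H|H].
    + exists (S n). auto.
    + exists k. split; [exact Pk|]. intros j Hj Pj.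
      destruct (Nat.eq_dec j (S n)) as [->|]; [contradiction|apply Hmax; [lia|exact Pj]].
Qed.

Section Ultrafilter.

Context (w : (nat -> Prop) -> Prop).
Hypothesis w_ultra : ultrafilter w.
Hypothesis w_np : nonprincipal w.

#[local] Instance ultrafilter_proper : ProperFilter w.
Proof.
  destruct w_ultra as [Htrue [Hfalse [Himp [Hand _]]]]. split.
  - intros P HP. apply NNPP. intros Hempty. apply Hfalse.
    apply Himp with (2 := HP). intros n Hn. apply Hempty. exists n. exact Hn.
  - split; [exact Htrue|exact Hand|exact Himp].
Qed.

Lemma ultrafilter_not (A : nat -> Prop) : ~ w A -> w (fun n => ~ A n).
Proof. intros H. destruct (proj2 (proj2 (proj2 (proj2 w_ultra))) A); tauto. Qed.

Lemma ultrafilter_ge (m : nat) : w (fun n => (m <= n)%nat).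
Proof.
  apply filter_imp with (fun n => forall i, (i <= m)%nat -> n <> i).
  - intros n Hn. destruct (Nat.le_gt_cases m n) as [|Hlt]; [assumption|].
    exfalso. exact (Hn n (Nat.lt_le_incl _ _ Hlt) eq_refl).
  - apply filter_forall_le. intros i _. apply ultrafilter_not, w_np.
Qed.

Lemma ultrafilter_diagonal (A : nat -> nat -> Prop) : (forall k, w (A k)) ->
  exists kappa : nat -> nat,
    forall k, w (fun n => (k <= kappa n)%nat /\ A (kappa n) n).
Proof.
  intros HA.
  set (good := fun n k => (k <= n)%nat /\ A k n).
  set (kappa := fun n => epsilon (inhabits O) (fun k =>
    (good n O -> good n k) /\ forall j, (j <= n)%nat -> good n j -> (j <= k)%nat)).
  exists kappa. intros k.
  apply filter_imp with (2 := filter_and _ _ (ultrafilter_ge k)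
    (filter_and _ _ (HA O) (HA k))).
  intros n [Hk [HA0 HAk]].
  destruct (epsilon_spec (inhabits O) _ (max_index_exists (good n) n)) as [Hgood Hmax].
  fold (kappa n) in Hgood, Hmax. split.
  - apply Hmax; [exact Hk|]. split; assumption.
  - apply Hgood. split; [lia|exact HA0].
Qed.

Lemma ultrafilter_filterlim_le (a b : nat -> R) (La Lb : R) :
  filterlim a w (locally La) -> filterlim b w (locally Lb) -> (forall n, a n <= b n) ->
  La <= Lb.
Proof. intros Ha Hb Hle. exact (filterlim_le a b La Lb (filter_forall _ Hle) Ha Hb). Qed.

Lemma ulim_filterlim (a : nat -> R) (L : R) : ulim w a L <-> filterlim a w (locally L).
Proof.
  split.
  - intros H. apply filterlim_locally. intros e. exact (H e (cond_pos e)).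
  - intros H e He. exact (proj1 (filterlim_locally a L) H (mkposreal e He)).
Qed.

Lemma bounded_filterlim_exists (a : nat -> R) (B : R) : (forall n, Rabs (a n) <= B) ->
  exists L, filterlim a w (locally L).
Proof.
  intros HB.
  assert (Hrange : forall n, - B <= a n <= B) by (intros n; apply Rabs_le_between, HB).
  destruct (completeness (fun r => w (fun n => r <= a n))) as [L [Hub Hlub]].
  - exists B. intros r Hr. destruct (filter_ex _ Hr) as [n Hn]. specialize (Hrange n). lra.
  - exists (- B). apply filter_forall. intros n. apply Hrange.
  - exists L. apply ulim_filterlim. intros e He.
    assert (Hlow : w (fun n => L - e < a n)).
    { apply NNPP. intros Hn. assert (L <= L - e); [|lra].
      apply Hlub. intros r Hr. destruct (Rle_or_lt r (L - e)) as [|Hlt]; [assumption|].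
      exfalso. apply Hn. apply filter_imp with (2 := Hr). intros; lra. }
    assert (Hhigh : w (fun n => ~ L + e <= a n)).
    { apply ultrafilter_not. intros Hw. specialize (Hub _ Hw). lra. }
    apply filter_imp with (2 := filter_and _ _ Hlow Hhigh). intros n [Ha Hb].
    apply Rabs_def1; lra.
Qed.

Definition ultralim (a : nat -> R) : R :=
  epsilon (inhabits 0) (fun L => filterlim a w (locally L)).

Lemma ultralim_correct (a : nat -> R) (B : R) : (forall n, Rabs (a n) <= B) ->
  filterlim a w (locally (ultralim a)).
Proof. intros HB. exact (epsilon_spec (inhabits 0) _ (bounded_filterlim_exists a B HB)). Qed.

Lemma ultralim_eq (a : nat -> R) (L : R) : filterlim a w (locally L) -> ultralim a = L.
Proof.
  intros H. assert (Hlim : filterlim a w (locally (ultralim a))).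
  { apply (epsilon_spec (inhabits 0) (fun L => filterlim a w (locally L))). exists L. exact H. }
  apply Rle_antisym.
  - apply (ultrafilter_filterlim_le a a _ _ Hlim H). auto with real.
  - apply (ultrafilter_filterlim_le a a _ _ H Hlim). auto with real.
Qed.

Section Ultracompletion.

Context {X : Type} {d : X -> X -> R} (d_pm : is_pseudometric d) (B : R).
Hypothesis d_bound : forall x y, d x y <= B.

Definition udist (x y : nat -> X) : R := ultralim (fun n => d (x n) (y n)).

Lemma udist_filterlim (x y : nat -> X) :
  filterlim (fun n => d (x n) (y n)) w (locally (udist x y)).
Proof.
  apply ultralim_correct with B. intros n.
  rewrite Rabs_pos_eq by apply (pdist_ge0 d_pm). apply d_bound.
Qed.

Lemma udist_le_bound (x y : nat -> X) : udist x y <= B.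
Proof.
  apply (ultrafilter_filterlim_le (fun n => d (x n) (y n)) (fun _ => B));
    [apply udist_filterlim|apply filterlim_const|auto].
Qed.

Lemma udist_le (x y : nat -> X) (c : R) : w (fun n => d (x n) (y n) <= c) -> udist x y <= c.
Proof.
  intros H. exact (filterlim_le _ (fun _ => c) (udist x y) c H (udist_filterlim x y)
    (filterlim_const c)).
Qed.

Lemma udist_lt (x y : nat -> X) (c : R) : udist x y < c -> w (fun n => d (x n) (y n) < c).
Proof.
  intros H. apply (udist_filterlim x y (fun r => r < c)). apply open_lt. exact H.
Qed.

Lemma udist_pseudometric : is_pseudometric udist.
Proof.
  split.
  - intros x y. apply (ultrafilter_filterlim_le (fun _ => 0) (fun n => d (x n) (y n)));
      [apply filterlim_const|apply udist_filterlim|].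
    intros n. apply (pdist_ge0 d_pm).
  - intros x. apply ultralim_eq. apply filterlim_ext with (fun _ => 0).
    + intros n. symmetry. apply (pdist_refl d_pm).
    + apply filterlim_const.
  - intros x y. apply ultralim_eq. apply filterlim_ext with (fun n => d (y n) (x n)).
    + intros n. apply (pdist_sym d_pm).
    + apply udist_filterlim.
  - intros x y z. apply (ultrafilter_filterlim_le (fun n => d (x n) (z n))
      (fun n => d (x n) (y n) + d (y n) (z n))).
    + apply udist_filterlim.
    + apply filterlim_Rplus; apply udist_filterlim.
    + intros n. apply (pdist_triangle d_pm).
Qed.

(* The limit is read off diagonally: its n-th entry is that of a late term up to which
   the n-th entries satisfy the Cauchy estimates. *)
Lemma udist_complete : complete_set udist (fun _ => True).
Proof.
  intros u _ Hc.
  set (N := fun i => epsilon (inhabits O) (fun N => forall j k, (N <= j)%nat -> (N <= k)%nat ->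
    udist (u j) (u k) < 1 / 2 ^ i)).
  assert (HN : forall i j k, (N i <= j)%nat -> (N i <= k)%nat -> udist (u j) (u k) < 1 / 2 ^ i).
  { intros i. apply (epsilon_spec (inhabits O) (fun N => forall j k, (N <= j)%nat ->
      (N <= k)%nat -> udist (u j) (u k) < 1 / 2 ^ i)). apply Hc, div_pow2_pos. lra. }
  destruct (ultrafilter_diagonal (fun k n => forall i, (i <= k)%nat -> forall j, (j <= k)%nat ->
    (N i <= j)%nat -> d (u j n) (u k n) < 1 / 2 ^ i)) as [kappa Hkappa].
  { intros k. apply filter_forall_le. intros i _. apply filter_forall_le. intros j Hj.
    destruct (Nat.le_gt_cases (N i) j) as [Hij|Hij].
    - apply filter_imp with (2 := udist_lt _ _ _ (HN i j k Hij ltac:(lia))). auto.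
    - apply filter_forall. lia. }
  exists (fun n => u (kappa n) n). split; [exact I|]. intros e He.
  destruct (div_pow2_lt 1 e He) as [i Hi]. exists (N i). intros j Hj.
  apply Rle_lt_trans with (2 := Hi i (Nat.le_refl _)). apply udist_le.
  apply filter_imp with (2 := Hkappa (max i j)). intros n [Hk Hd].
  left. apply Hd; lia || exact Hj.
Qed.

Definition constant_seq (x : nat -> X) : Prop := exists a, forall n, x n = a.

Lemma constant_seq_0 (x : nat -> X) (n : nat) : constant_seq x -> x n = x O.
Proof. intros [a Ha]. rewrite !Ha. reflexivity. Qed.

Lemma constant_seq_const (a : X) : constant_seq (fun _ => a).
Proof. exists a. reflexivity. Qed.

Lemma udist_constant_seq (x y : nat -> X) : constant_seq x -> constant_seq y ->
  udist x y = d (x O) (y O).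
Proof.
  intros Hx Hy. apply ultralim_eq. apply filterlim_ext with (fun _ => d (x O) (y O)).
  - intros n. rewrite (constant_seq_0 x n Hx), (constant_seq_0 y n Hy). reflexivity.
  - apply filterlim_const.
Qed.

Lemma constant_seq_complete : complete d -> complete_set udist constant_seq.
Proof.
  intros Hcomp u Hu Hc. destruct (Hcomp (fun m => u m O)) as [a Ha].
  - intros e He. destruct (Hc e He) as [N HN]. exists N. intros m k Hm Hk.
    rewrite <- udist_constant_seq; auto.
  - exists (fun _ => a). split; [apply constant_seq_const|].
    intros e He. destruct (Ha e He) as [N HN]. exists N. intros m Hm.
    rewrite udist_constant_seq; auto using constant_seq_const.
Qed.

Definition cone_represents (u : nat -> cone X) (U : cone (nat -> X)) : Prop :=
  filterlim (fun n => rad (u n)) w (locally (rad U)) /\ forall n, dir (u n) = dir U n.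

Lemma cone_ip_filterlim (u v : nat -> cone X) (U V : cone (nat -> X)) :
  cone_represents u U -> cone_represents v V ->
  filterlim (fun n => cone_ip d (u n) (v n)) w (locally (cone_ip udist U V)).
Proof.
  intros [Hu Eu] [Hv Ev]. apply filterlim_Rmult; [apply filterlim_Rmult; assumption|].
  apply filterlim_ext with (fun n => cos (d (dir U n) (dir V n))).
  - intros n. rewrite Eu, Ev. reflexivity.
  - apply filterlim_comp with (1 := udist_filterlim (dir U) (dir V)). apply continuous_cos.
Qed.

Lemma constant_rad_represents (U : cone (nat -> X)) :
  cone_represents (fun n => ConePoint (rad U) (dir U n) (rad_ge0 U)) U.
Proof. split; [apply filterlim_const|reflexivity]. Qed.

Lemma is_cone_sum_represents (u v s : nat -> cone X) (U V S : cone (nat -> X)) :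
  cone_represents u U -> cone_represents v V -> cone_represents s S ->
  (forall n, is_cone_sum d (u n) (v n) (s n)) -> is_cone_sum udist U V S.
Proof.
  intros Hu Hv Hs Hsum.
  pose proof (cone_ip_filterlim u v U V Hu Hv) as Huv.
  split.
  - rewrite <- !(cone_ip_diag udist_pseudometric).
    apply (ultrafilter_filterlim_le (fun n => cone_ip d (s n) (s n))
      (fun n => cone_ip d (u n) (u n) + cone_ip d (v n) (v n) + 2 * cone_ip d (u n) (v n))).
    + apply cone_ip_filterlim; assumption.
    + apply filterlim_Rplus; [apply filterlim_Rplus; apply cone_ip_filterlim; assumption|].
      apply filterlim_Rmult; [apply filterlim_const|exact Huv].
    + intros n. rewrite !(cone_ip_diag d_pm). apply Hsum.
  - intros W. pose proof (constant_rad_represents W) as Hw.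
    eapply ultrafilter_filterlim_le; [|apply cone_ip_filterlim; [exact Hw|exact Hs]|].
    + apply filterlim_Rplus; apply cone_ip_filterlim; [exact Hw|exact Hu|exact Hw|exact Hv].
    + intros n. apply Hsum.
Qed.

Lemma ultracompletion_has_cone_sums :
  has_cone_sums d (fun _ => True) -> has_cone_sums udist constant_seq.
Proof.
  intros Hsums V W.
  set (v := fun n => ConePoint (rad V) (dir V n) (rad_ge0 V)).
  set (v' := fun n => ConePoint (rad W) (dir W n) (rad_ge0 W)).
  set (s := fun n => cone_sum d (fun _ => True) (v n) (v' n)).
  assert (Hs : forall n, is_cone_sum d (v n) (v' n) (s n)).
  { intros n. apply cone_sum_spec, Hsums. }
  assert (Hbound : forall n, Rabs (rad (s n)) <= rad V + rad W).
  { intros n. rewrite Rabs_pos_eq by apply rad_ge0.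
    pose proof (rad_ge0 V) as HV. pose proof (rad_ge0 W) as HW.
    apply pow2_le_reg; [lra|]. apply Rle_trans with (1 := proj1 (Hs n)).
    unfold cone_ip. simpl rad.
    pose proof (COS_bound (d (dir (v n)) (dir (v' n)))).
    pose proof (Rmult_le_pos _ _ HV HW). nra. }
  pose proof (ultralim_correct _ _ Hbound) as Hlim.
  assert (Hrad : 0 <= ultralim (fun n => rad (s n))).
  { apply (ultrafilter_filterlim_le (fun _ => 0) (fun n => rad (s n)));
      [apply filterlim_const|exact Hlim|]. intros n. apply rad_ge0. }
  exists (ConePoint (ultralim (fun n => rad (s n))) (fun n => dir (s n)) Hrad). split.
  - apply (is_cone_sum_represents v v' s); try apply constant_rad_represents; [|exact Hs].
    split; [exact Hlim|reflexivity].
  - intros HV HW. exists (dir (s O)). intros n. simpl. unfold s, v, v'.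
    rewrite (constant_seq_0 _ n HV), (constant_seq_0 _ n HW). reflexivity.
Qed.

End Ultracompletion.

Theorem ultracompletion_short_retraction {X : Type} (d : X -> X -> R) (p : X) :
  is_metric d -> complete d -> (forall x y, d x y <= PI) -> (forall x, d p x <= PI / 2) ->
  has_cone_sums d (fun _ => True) -> exists f, short_retraction d w f.
Proof.
  intros Hmet Hcomp Hdiam Hp Hsums. pose proof (is_metric_pseudometric d Hmet) as d_pm.
  assert (Hu : forall x, udist (d := d) (fun _ => p) x <= PI / 2).
  { intros x. apply (udist_le d_pm PI Hdiam). apply filter_forall. intros n. apply Hp. }
  destruct (cone_sums_retraction (udist_pseudometric d_pm PI Hdiam) (udist_le_bound d_pm PI Hdiam)
    constant_seq (fun _ => p)) as [f [Hin [Hshort Hfix]]].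
  - exact (udist_complete d_pm PI Hdiam).
  - apply constant_seq_complete, Hcomp.
  - exact (ultracompletion_has_cone_sums d_pm PI Hdiam Hsums).
  - apply constant_seq_const.
  - exact Hu.
  - exists (fun x => f x O). split.
    + intros x y L HL. rewrite <- udist_constant_seq by apply Hin.
      apply Rle_trans with (1 := Hshort x y). right. apply ultralim_eq, ulim_filterlim, HL.
    + intros x. apply Hmet.
      rewrite <- (udist_constant_seq _ (fun _ => x)) by (apply Hin || apply constant_seq_const).
      apply Hfix, constant_seq_const.
Qed.

End Ultrafilter.

Theorem theorem1p3 (X : Type) (d : X -> X -> R)
  (Hmet : is_metric d) (Hcomplete : complete d)
  (Hlength : length_space d) (Hcat : CAT1 d)
  (p : X) (Hp : forall x : X, d p x <= PI / 2) :
  one_complemented d.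
Proof.
  pose proof (is_metric_pseudometric d Hmet) as d_pm.
  assert (Hdiam : forall x y, d x y <= PI).
  { intros x y. pose proof (pdist_triangle d_pm x p y) as H.
    rewrite (pdist_sym d_pm x p) in H. pose proof (Hp x). pose proof (Hp y). lra. }
  destruct nonprincipal_ultrafilter_exists as [w [w_ultra w_np]].
  exists w. split; [exact w_ultra|]. split; [exact w_np|].
  apply (ultracompletion_short_retraction w w_ultra w_np d p); try assumption.
  exact (CAT1_has_cone_sums d_pm Hcat Hdiam).
Qed.
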